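(* Let $Y$ be an infinite dimensional Banach space containing no isomorphic copy of $\ell_1$. If the pair $(\ell_1,Y)$ has the adjoint compact perturbation property (ACPP), then $Y$ has the local diameter 2 property (LD2P).
   Context: The scalar field is $\mathbb{K}=\mathbb{R}$ or $\mathbb{C}$. For Banach spaces $X,Y$, $\mathcal{L}(X,Y)$ is the Banach space of bounded linear operators and $\mathcal{K}(X,Y)$ the subspace of compact operators; $S_X$, $B_X$ are the unit sphere and closed unit ball of $X$. An operator $T$ attains its norm if there is $x$ in the unit sphere of its domain with $\|Tx\|=\|T\|$. The essential norm is $\|T\|_e=\inf_{K\in\mathcal{K}(X,Y)}\|T-K\|$. The pair $(X,Y)$ has the ACPP if every $T\in\mathcal{L}(X,Y)$ whose adjoint $T^*:Y^*\to X^*$ does not attain its norm satisfies $\|T\|_e=\|T\|$. A slice of $B_Y$ is a set $S(y^*,\delta)=\{y\in B_Y:\operatorname{Re} y^*(y)>1-\delta\}$ with $y^*\in S_{Y^*}$ and $\delta>0$. $Y$ has the LD2P if every slice of $B_Y$ has diameter $2$. *)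

(* Defs.v *)
From Stdlib Require Import Reals Lra Lia FunctionalExtensionality ProofIrrelevance.
From Coquelicot Require Import Coquelicot.

Set Implicit Arguments.
Unset Strict Implicit.
Unset Printing Implicit Defensive.

Open Scope R_scope.

Inductive scalars : Set := RealScalars | ComplexScalars.

Definition field (F : scalars) : AbsRing :=
  match F with RealScalars => R_AbsRing | ComplexScalars => C_AbsRing end.

Definition re (F : scalars) : field F -> R :=
  match F return field F -> R with
  | RealScalars => fun x : R => x
  | ComplexScalars => Re
  end.

Definition of_R (F : scalars) : R -> field F :=
  match F return R -> field F with
  | RealScalars => fun x : R => x
  | ComplexScalars => RtoC
  end.

Lemma field_mult_comm (F : scalars) (a b : field F) : mult a b = mult b a.
Proof.
  destruct F; [exact (Rmult_comm a b) | exact (Cmult_comm a b)].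
Qed.

Lemma abs_of_R (F : scalars) (t : R) : abs (of_R F t) = Rabs t.
Proof. destruct F; [reflexivity | exact (Cmod_R t)]. Qed.

Lemma of_R_mult (F : scalars) (s t : R) :
  mult (of_R F s) (of_R F t) = of_R F (s * t).
Proof.
  destruct F; [reflexivity | symmetry; exact (RtoC_mult s t)].
Qed.

Lemma of_R_one (F : scalars) : of_R F 1 = one.
Proof. destruct F; reflexivity. Qed.

(** * Bounded linear operators *)

Record bop (F : scalars) (X Y : NormedModule (field F)) : Type := Bop
  { bop_fun :> X -> Y;
    bop_linear : is_linear bop_fun }.

Section Operators.

Variables (F : scalars) (X Y : NormedModule (field F)).

Lemma bop_ext (S T : bop X Y) : (forall x, S x = T x) -> S = T.
Proof.
  destruct S as [s hs], T as [t ht]; simpl; intros H.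
  assert (E : s = t) by (apply functional_extensionality; exact H).
  subst t; f_equal; apply proof_irrelevance.
Qed.

Lemma bop_map_zero (T : bop X Y) : T zero = zero.
Proof.
  transitivity (T (scal zero zero)).
  - f_equal; symmetry; exact (@scal_zero_l (field F) X zero).
  - rewrite (linear_scal _ (bop_linear T)); exact (@scal_zero_l (field F) Y (T zero)).
Qed.

Definition op_norm (T : bop X Y) : R :=
  real (Lub_Rbar (fun r => exists x : X, norm x <= 1 /\ r = norm (T x))).

Lemma op_norm_lub (T : bop X Y) :
  is_lub_Rbar (fun r => exists x : X, norm x <= 1 /\ r = norm (T x))
    (Finite (op_norm T)).
Proof.
  unfold op_norm.
  set (E := fun r => exists x : X, norm x <= 1 /\ r = norm (T x)).
  destruct (Lub_Rbar_correct E) as [ub least].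
  destruct (linear_norm _ (bop_linear T)) as [M [M0 HM]].
  assert (E0 : E (norm (T zero))).
  { exists zero; split; [rewrite norm_zero; lra | reflexivity]. }
  assert (HMb : is_ub_Rbar E (Finite M)).
  { intros r [x [hx ->]]; simpl.
    apply Rle_trans with (1 := HM x).
    rewrite <- (Rmult_1_r M) at 2.
    apply Rmult_le_compat_l; lra. }
  generalize (least _ HMb) (ub _ E0).
  destruct (Lub_Rbar E); simpl; intros h1 h0.
  - split; assumption.
  - contradiction.
  - contradiction.
Qed.

Lemma op_norm_ball (T : bop X Y) (x : X) :
  norm x <= 1 -> norm (T x) <= op_norm T.
Proof.
  intros hx; apply (proj1 (op_norm_lub T)); exists x; auto.
Qed.

Lemma op_norm_le (T : bop X Y) (M : R) :
  (forall x : X, norm x <= 1 -> norm (T x) <= M) -> op_norm T <= M.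
Proof.
  intros H; apply (proj2 (op_norm_lub T) (Finite M)).
  intros r [x [hx ->]]; exact (H x hx).
Qed.

Lemma op_norm_ge_0 (T : bop X Y) : 0 <= op_norm T.
Proof.
  apply Rle_trans with (norm (T zero)); [apply norm_ge_0 |].
  apply op_norm_ball; rewrite norm_zero; lra.
Qed.

Lemma op_norm_bound (T : bop X Y) (x : X) : norm (T x) <= op_norm T * norm x.
Proof.
  destruct (Req_dec (norm x) 0) as [h0 | h0].
  - rewrite (norm_eq_zero x h0), bop_map_zero, !norm_zero; lra.
  - assert (hp : 0 < norm x) by (generalize (norm_ge_0 x); lra).
    set (u := scal (of_R F (/ norm x)) x).
    assert (hu : norm u <= 1).
    { eapply Rle_trans; [apply norm_scal |].
      rewrite abs_of_R, Rabs_pos_eq.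
      - rewrite Rinv_l; lra.
      - left; apply Rinv_0_lt_compat, hp. }
    assert (ex : x = scal (of_R F (norm x)) u).
    { unfold u; rewrite scal_assoc, of_R_mult, Rinv_r, of_R_one, scal_one; auto. }
    rewrite ex at 1.
    rewrite (linear_scal _ (bop_linear T)).
    eapply Rle_trans; [apply norm_scal |].
    rewrite abs_of_R, Rabs_pos_eq, Rmult_comm by lra.
    apply Rmult_le_compat_r; [lra | apply op_norm_ball, hu].
Qed.

Lemma bop_of_bound (f : X -> Y) (M : R) :
  (forall x y, f (plus x y) = plus (f x) (f y)) ->
  (forall a x, f (scal a x) = scal a (f x)) ->
  (forall x, norm (f x) <= M * norm x) -> is_linear f.
Proof.
  intros h1 h2 h3; split; auto.
  exists (Rmax M 1); split.
  - apply Rlt_le_trans with 1; [lra | apply Rmax_r].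
  - intros x; apply Rle_trans with (1 := h3 x).
    apply Rmult_le_compat_r; [apply norm_ge_0 | apply Rmax_l].
Qed.

Lemma bop_plus_linear (S T : bop X Y) : is_linear (fun x => plus (S x) (T x)).
Proof.
  apply bop_of_bound with (op_norm S + op_norm T).
  - intros x y.
    rewrite (linear_plus _ (bop_linear S)), (linear_plus _ (bop_linear T)).
    rewrite <- !plus_assoc; f_equal.
    rewrite !plus_assoc; f_equal; apply plus_comm.
  - intros a x.
    rewrite (linear_scal _ (bop_linear S)), (linear_scal _ (bop_linear T)).
    symmetry; exact (@scal_distr_l (field F) Y a (S x) (T x)).
  - intros x; eapply Rle_trans; [apply norm_triangle |].
    generalize (op_norm_bound S x) (op_norm_bound T x); lra.
Qed.

Lemma bop_zero_linear : is_linear (fun _ : X => zero : Y).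
Proof.
  apply bop_of_bound with 0.
  - intros; now rewrite plus_zero_l.
  - intros a x; symmetry; exact (@scal_zero_r (field F) Y a).
  - intros x; rewrite norm_zero; lra.
Qed.

Lemma bop_scal_linear (a : field F) (T : bop X Y) :
  is_linear (fun x => scal a (T x)).
Proof.
  apply bop_of_bound with (abs a * op_norm T).
  - intros x y; rewrite (linear_plus _ (bop_linear T)).
    exact (@scal_distr_l (field F) Y a (T x) (T y)).
  - intros b x; rewrite (linear_scal _ (bop_linear T)), !scal_assoc.
    now rewrite field_mult_comm.
  - intros x; eapply Rle_trans; [apply norm_scal |].
    rewrite Rmult_assoc; apply Rmult_le_compat_l; [apply abs_ge_0 |].
    apply op_norm_bound.
Qed.

Lemma bop_opp_linear (T : bop X Y) : is_linear (fun x => opp (T x)).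
Proof.
  apply bop_of_bound with (op_norm T).
  - intros x y; rewrite (linear_plus _ (bop_linear T)); exact (@opp_plus Y (T x) (T y)).
  - intros b x; rewrite (linear_scal _ (bop_linear T)).
    symmetry; exact (@scal_opp_r (field F) Y b (T x)).
  - intros x; rewrite norm_opp; apply op_norm_bound.
Qed.

Definition bop_plus (S T : bop X Y) : bop X Y := Bop (bop_plus_linear S T).
Definition bop_zero : bop X Y := Bop bop_zero_linear.
Definition bop_opp (T : bop X Y) : bop X Y := Bop (bop_opp_linear T).
Definition bop_scal (a : field F) (T : bop X Y) : bop X Y :=
  Bop (bop_scal_linear a T).

Lemma bop_plus_comm (S T : bop X Y) : bop_plus S T = bop_plus T S.
Proof. apply bop_ext; intros x; apply plus_comm. Qed.

Lemma bop_plus_assoc (S T U : bop X Y) :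
  bop_plus S (bop_plus T U) = bop_plus (bop_plus S T) U.
Proof. apply bop_ext; intros x; apply plus_assoc. Qed.

Lemma bop_plus_zero (T : bop X Y) : bop_plus T bop_zero = T.
Proof. apply bop_ext; intros x; apply plus_zero_r. Qed.

Lemma bop_plus_opp (T : bop X Y) : bop_plus T (bop_opp T) = bop_zero.
Proof. apply bop_ext; intros x; exact (@plus_opp_r Y (T x)). Qed.

Definition bop_AbelianMonoid_mixin :=
  AbelianMonoid.Mixin (bop X Y) _ _ bop_plus_comm bop_plus_assoc bop_plus_zero.

Canonical bop_AbelianMonoid :=
  AbelianMonoid.Pack (bop X Y) bop_AbelianMonoid_mixin (bop X Y).

Definition bop_AbelianGroup_mixin :=
  AbelianGroup.Mixin bop_AbelianMonoid _ bop_plus_opp.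

Canonical bop_AbelianGroup :=
  AbelianGroup.Pack (bop X Y)
    (AbelianGroup.Class (bop X Y) bop_AbelianMonoid_mixin bop_AbelianGroup_mixin)
    (bop X Y).

Lemma bop_scal_assoc (a b : field F) (T : bop X Y) :
  bop_scal a (bop_scal b T) = bop_scal (mult a b) T.
Proof. apply bop_ext; intros x; exact (@scal_assoc (field F) Y a b (T x)). Qed.

Lemma bop_scal_one (T : bop X Y) : bop_scal one T = T.
Proof. apply bop_ext; intros x; exact (@scal_one (field F) Y (T x)). Qed.

Lemma bop_scal_distr_l (a : field F) (S T : bop X Y) :
  bop_scal a (plus S T) = plus (bop_scal a S) (bop_scal a T).
Proof. apply bop_ext; intros x; exact (@scal_distr_l (field F) Y a (S x) (T x)). Qed.

Lemma bop_scal_distr_r (a b : field F) (T : bop X Y) :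
  bop_scal (plus a b) T = plus (bop_scal a T) (bop_scal b T).
Proof. apply bop_ext; intros x; exact (@scal_distr_r (field F) Y a b (T x)). Qed.

Definition bop_ModuleSpace_mixin :=
  ModuleSpace.Mixin (field F) bop_AbelianGroup _
    bop_scal_assoc bop_scal_one bop_scal_distr_l bop_scal_distr_r.

Canonical bop_ModuleSpace :=
  ModuleSpace.Pack (field F) (bop X Y)
    (ModuleSpace.Class (field F) (bop X Y) _ bop_ModuleSpace_mixin) (bop X Y).

Lemma op_norm_triangle (S T : bop X Y) :
  op_norm (plus S T) <= op_norm S + op_norm T.
Proof.
  apply op_norm_le; intros x hx.
  eapply Rle_trans; [apply (norm_triangle (S x) (T x)) |].
  apply Rplus_le_compat; apply op_norm_ball, hx.
Qed.

Lemma op_norm_scal (a : field F) (T : bop X Y) :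
  op_norm (scal a T) <= abs a * op_norm T.
Proof.
  apply op_norm_le; intros x hx.
  eapply Rle_trans; [apply (norm_scal a (T x)) |].
  apply Rmult_le_compat_l; [apply abs_ge_0 | apply op_norm_ball, hx].
Qed.

Lemma op_norm_eq_zero (T : bop X Y) : op_norm T = 0 -> T = zero.
Proof.
  intros h; apply bop_ext; intros x; apply norm_eq_zero.
  generalize (op_norm_bound T x) (norm_ge_0 (T x)); rewrite h; lra.
Qed.

Lemma op_norm_zero : op_norm zero = 0.
Proof.
  apply Rle_antisym; [| apply op_norm_ge_0].
  apply op_norm_le; intros x _; apply Req_le, (@norm_zero _ Y).
Qed.

Lemma op_norm_opp (T : bop X Y) : op_norm (opp T) = op_norm T.
Proof.
  apply Rle_antisym; apply op_norm_le; intros x hx.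
  - apply Rle_trans with (2 := op_norm_ball T hx), Req_le, (norm_opp (T x)).
  - apply Rle_trans with (2 := op_norm_ball (opp T) hx), Req_le.
    symmetry; apply (norm_opp (T x)).
Qed.

Definition bop_ball (S : bop X Y) (e : R) (T : bop X Y) : Prop :=
  op_norm (minus T S) < e.

Lemma bop_ball_center (S : bop X Y) (e : posreal) : bop_ball S e S.
Proof.
  apply Rle_lt_trans with (op_norm (zero : bop X Y)).
  - apply Req_le, f_equal; exact (@minus_eq_zero bop_AbelianGroup S).
  - rewrite op_norm_zero; apply cond_pos.
Qed.

Lemma bop_ball_sym (S T : bop X Y) (e : R) : bop_ball S e T -> bop_ball T e S.
Proof. unfold bop_ball; now rewrite <- (opp_minus T S), op_norm_opp. Qed.

Lemma bop_ball_triangle (S T U : bop X Y) (e1 e2 : R) :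
  bop_ball S e1 T -> bop_ball T e2 U -> bop_ball S (e1 + e2) U.
Proof.
  unfold bop_ball; intros h1 h2.
  rewrite (minus_trans T).
  eapply Rle_lt_trans; [apply op_norm_triangle | lra].
Qed.

Definition bop_UniformSpace_mixin :=
  UniformSpace.Mixin (bop X Y) zero _
    bop_ball_center bop_ball_sym bop_ball_triangle.

Canonical bop_UniformSpace :=
  UniformSpace.Pack (bop X Y) bop_UniformSpace_mixin (bop X Y).

Canonical bop_NormedModuleAux :=
  NormedModuleAux.Pack (field F) (bop X Y)
    (NormedModuleAux.Class (field F) (bop X Y)
       (ModuleSpace.class _ bop_ModuleSpace) bop_UniformSpace_mixin) (bop X Y).

Lemma bop_norm_compat1 (S T : bop X Y) (e : R) :
  op_norm (minus T S) < e -> ball S e T.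
Proof. intros h; exact h. Qed.

Lemma bop_norm_compat2 (S T : bop X Y) (e : posreal) :
  ball S e T -> op_norm (minus T S) < 1 * e.
Proof. rewrite Rmult_1_l; intros h; exact h. Qed.

Definition bop_NormedModule_mixin :=
  NormedModule.Mixin (field F) bop_NormedModuleAux op_norm 1
    op_norm_triangle op_norm_scal bop_norm_compat1 bop_norm_compat2
    op_norm_eq_zero.

Canonical bop_NormedModule :=
  NormedModule.Pack (field F) (bop X Y)
    (NormedModule.Class (field F) (bop X Y) _ bop_NormedModule_mixin) (bop X Y).

End Operators.

Definition dual (F : scalars) (X : NormedModule (field F)) :
  NormedModule (field F) :=
  bop_NormedModule X (AbsRing_NormedModule (field F)).

(** * Adjoint, compactness and the essential norm *)

Section Adjoint.

Variables (F : scalars) (X Y : NormedModule (field F)).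

Definition bop_comp (Z : NormedModule (field F)) (S : bop Y Z) (T : bop X Y) :
  bop X Z :=
  Bop (is_linear_comp _ _ (bop_linear T) (bop_linear S)).

Lemma op_norm_comp (Z : NormedModule (field F)) (S : bop Y Z) (T : bop X Y) :
  op_norm (bop_comp S T) <= op_norm T * op_norm S.
Proof.
  apply op_norm_le; intros x hx; simpl.
  eapply Rle_trans; [apply op_norm_bound |].
  rewrite Rmult_comm; apply Rmult_le_compat_r; [apply op_norm_ge_0 |].
  apply op_norm_ball, hx.
Qed.

Lemma adjoint_linear (T : bop X Y) :
  is_linear (fun f : dual Y => bop_comp f T : dual X).
Proof.
  apply bop_of_bound with (op_norm T).
  - intros f g; apply bop_ext; intros x; reflexivity.
  - intros a f; apply bop_ext; intros x; reflexivity.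
  - intros f; exact (op_norm_comp f T).
Qed.

Definition adjoint (T : bop X Y) : bop (dual Y) (dual X) :=
  Bop (adjoint_linear T).

Definition attains_norm (T : bop X Y) : Prop :=
  exists x : X, norm x = 1 /\ norm (T x) = norm T.

(** [T] maps the closed unit ball onto a relatively compact set; in the metric
    space [Y] this is relative sequential compactness. *)
Definition compact_op (T : bop X Y) : Prop :=
  forall x : nat -> X, (forall n, norm (x n) <= 1) ->
  exists (phi : nat -> nat) (l : Y),
    (forall n, (phi n < phi (S n))%nat) /\
    filterlim (fun n => T (x (phi n))) eventually (locally l).

Definition ess_norm (T : bop X Y) : R :=
  real (Glb_Rbar (fun r => exists K : bop X Y,
    compact_op K /\ r = norm (minus T K))).

Lemma compact_op_zero : compact_op (zero : bop X Y).
Proof.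
  intros x _; exists (fun n => n), zero; split.
  - intros n; apply Nat.lt_succ_diag_r.
  - exact (filterlim_const (zero : Y)).
Qed.

Lemma ess_norm_glb (T : bop X Y) :
  is_glb_Rbar (fun r => exists K : bop X Y,
    compact_op K /\ r = norm (minus T K)) (Finite (ess_norm T)).
Proof.
  unfold ess_norm.
  set (E := fun r => exists K : bop X Y, compact_op K /\ r = norm (minus T K)).
  destruct (Glb_Rbar_correct E) as [lb greatest].
  assert (E0 : E (norm (minus T zero))).
  { exists zero; split; [apply compact_op_zero | reflexivity]. }
  assert (H0 : is_lb_Rbar E (Finite 0)).
  { intros r [K [_ ->]]; apply norm_ge_0. }
  generalize (greatest _ H0) (lb _ E0).
  destruct (Glb_Rbar E); simpl; intros h0 h1.
  - split; assumption.
  - contradiction.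
  - contradiction.
Qed.

End Adjoint.

Definition ACPP (F : scalars) (X Y : NormedModule (field F)) : Prop :=
  forall T : bop X Y, ~ attains_norm (adjoint T) -> ess_norm T = norm T.

(** * Geometry of a normed space *)

Section Geometry.

Variables (F : scalars) (Y : NormedModule (field F)).

Definition slice (f : dual Y) (delta : R) (y : Y) : Prop :=
  norm y <= 1 /\ re (f y) > 1 - delta.

Definition diameter (A : Y -> Prop) : Rbar :=
  Lub_Rbar (fun r => exists u v : Y, A u /\ A v /\ r = norm (minus u v)).

Definition LD2P : Prop :=
  forall (f : dual Y) (delta : R), norm f = 1 -> 0 < delta ->
  diameter (slice f delta) = Finite 2.

(** [sum_n _ n] has [n + 1] terms, so the spanning family is nonempty; the zero
    space is covered by the family [zero]. *)
Definition finite_dimensional : Prop :=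
  exists (n : nat) (b : nat -> Y), forall y : Y,
  exists a : nat -> field F, y = sum_n (fun i => scal (a i) (b i)) n.

End Geometry.

(** [X] is linearly homeomorphic to a subspace of [Y]. *)
Definition contains_copy (F : scalars) (X Y : NormedModule (field F)) : Prop :=
  exists (U : bop X Y) (c : R),
    0 < c /\ forall x : X, c * norm x <= norm (U x).

(** * The space of absolutely summable sequences *)

Record l1_type (F : scalars) : Type := L1
  { l1_seq :> nat -> field F;
    l1_summable : ex_series (fun n => abs (l1_seq n)) }.

Section EllOne.

Variable F : scalars.

Notation l1T := (l1_type F).

Lemma l1_ext (u v : l1T) : (forall n, u n = v n) -> u = v.
Proof.
  destruct u as [u hu], v as [v hv]; simpl; intros H.
  assert (E : u = v) by (apply functional_extensionality; exact H).
  subst v; f_equal; apply proof_irrelevance.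
Qed.

Definition l1_norm (u : l1T) : R := Series (fun n => abs (u n)).

Lemma l1_dominated (u : nat -> field F) (b : nat -> R) :
  (forall n, abs (u n) <= b n) -> ex_series b -> ex_series (fun n => abs (u n)).
Proof.
  intros h hb; apply (@ex_series_le R_AbsRing R_CompleteNormedModule _ b); auto.
  intros n; change (Rabs (abs (u n)) <= b n).
  rewrite Rabs_pos_eq; [apply h | apply abs_ge_0].
Qed.

Lemma l1_plus_summable (u v : l1T) :
  ex_series (fun n => abs (plus (u n) (v n))).
Proof.
  apply l1_dominated with (fun n => abs (u n) + abs (v n)).
  - intros n; apply abs_triangle.
  - exact (ex_series_plus _ _ (l1_summable u) (l1_summable v)).
Qed.

Lemma l1_scal_summable (a : field F) (u : l1T) :
  ex_series (fun n => abs (mult a (u n))).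
Proof.
  apply l1_dominated with (fun n => abs a * abs (u n)).
  - intros n; apply abs_mult.
  - exact (ex_series_scal (abs a) _ (l1_summable u)).
Qed.

Lemma l1_opp_summable (u : l1T) : ex_series (fun n => abs (opp (u n))).
Proof.
  apply l1_dominated with (fun n => abs (u n)).
  - intros n; rewrite abs_opp; apply Rle_refl.
  - apply l1_summable.
Qed.

Lemma l1_zero_summable : ex_series (fun _ : nat => abs (zero : field F)).
Proof.
  exists 0; apply is_series_ext with (fun _ : nat => 0).
  - intros _; symmetry; apply abs_zero.
  - unfold is_series; apply filterlim_ext with (fun _ : nat => 0).
    + intros n; rewrite sum_n_const; ring.
    + apply filterlim_const.
Qed.

Definition l1_plus (u v : l1T) : l1T := L1 (l1_plus_summable u v).
Definition l1_scal (a : field F) (u : l1T) : l1T := L1 (l1_scal_summable a u).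
Definition l1_opp (u : l1T) : l1T := L1 (l1_opp_summable u).
Definition l1_zero : l1T := L1 l1_zero_summable.

Lemma l1_plus_comm (u v : l1T) : l1_plus u v = l1_plus v u.
Proof. apply l1_ext; intros n; apply plus_comm. Qed.

Lemma l1_plus_assoc (u v w : l1T) :
  l1_plus u (l1_plus v w) = l1_plus (l1_plus u v) w.
Proof. apply l1_ext; intros n; apply plus_assoc. Qed.

Lemma l1_plus_zero (u : l1T) : l1_plus u l1_zero = u.
Proof. apply l1_ext; intros n; apply plus_zero_r. Qed.

Lemma l1_plus_opp (u : l1T) : l1_plus u (l1_opp u) = l1_zero.
Proof. apply l1_ext; intros n; exact (@plus_opp_r (field F) (u n)). Qed.

Definition l1_AbelianMonoid_mixin :=
  AbelianMonoid.Mixin l1T _ _ l1_plus_comm l1_plus_assoc l1_plus_zero.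

Canonical l1_AbelianMonoid :=
  AbelianMonoid.Pack l1T l1_AbelianMonoid_mixin l1T.

Definition l1_AbelianGroup_mixin :=
  AbelianGroup.Mixin l1_AbelianMonoid _ l1_plus_opp.

Canonical l1_AbelianGroup :=
  AbelianGroup.Pack l1T
    (AbelianGroup.Class l1T l1_AbelianMonoid_mixin l1_AbelianGroup_mixin) l1T.

Lemma l1_scal_assoc (a b : field F) (u : l1T) :
  l1_scal a (l1_scal b u) = l1_scal (mult a b) u.
Proof. apply l1_ext; intros n; exact (@mult_assoc (field F) a b (u n)). Qed.

Lemma l1_scal_one (u : l1T) : l1_scal one u = u.
Proof. apply l1_ext; intros n; exact (@mult_one_l (field F) (u n)). Qed.

Lemma l1_scal_distr_l (a : field F) (u v : l1T) :
  l1_scal a (plus u v) = plus (l1_scal a u) (l1_scal a v).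
Proof. apply l1_ext; intros n; exact (@mult_distr_l (field F) a (u n) (v n)). Qed.

Lemma l1_scal_distr_r (a b : field F) (u : l1T) :
  l1_scal (plus a b) u = plus (l1_scal a u) (l1_scal b u).
Proof. apply l1_ext; intros n; exact (@mult_distr_r (field F) a b (u n)). Qed.

Definition l1_ModuleSpace_mixin :=
  ModuleSpace.Mixin (field F) l1_AbelianGroup _
    l1_scal_assoc l1_scal_one l1_scal_distr_l l1_scal_distr_r.

Canonical l1_ModuleSpace :=
  ModuleSpace.Pack (field F) l1T
    (ModuleSpace.Class (field F) l1T _ l1_ModuleSpace_mixin) l1T.

Lemma l1_norm_triangle (u v : l1T) : l1_norm (plus u v) <= l1_norm u + l1_norm v.
Proof.
  unfold l1_norm.
  rewrite <- Series_plus; [| apply l1_summable | apply l1_summable].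
  apply Series_le.
  - intros n; split; [apply abs_ge_0 | apply (abs_triangle (u n) (v n))].
  - exact (ex_series_plus _ _ (l1_summable u) (l1_summable v)).
Qed.

Lemma l1_norm_scal (a : field F) (u : l1T) :
  l1_norm (scal a u) <= abs a * l1_norm u.
Proof.
  unfold l1_norm; rewrite <- Series_scal_l.
  apply Series_le.
  - intros n; split; [apply abs_ge_0 | apply (abs_mult a (u n))].
  - exact (ex_series_scal (abs a) _ (l1_summable u)).
Qed.

Lemma l1_norm_coord (u : l1T) (n : nat) : abs (u n) <= l1_norm u.
Proof.
  apply Rle_trans with (sum_n (fun k => abs (u k)) n).
  - destruct n as [| n].
    + rewrite sum_O; apply Rle_refl.
    + rewrite sum_Sn.
      change (abs (u (S n)) <= sum_n (fun k => abs (u k)) n + abs (u (S n))).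
      assert (H : 0 <= sum_n (fun k => abs (u k)) n).
      { rewrite sum_n_Reals; apply cond_pos_sum; intros k; apply abs_ge_0. }
      lra.
  - apply (is_lim_seq_incr_compare (sum_n (fun k => abs (u k)))).
    + exact (Series_correct _ (l1_summable u)).
    + intros m; rewrite sum_Sn.
      change (sum_n (fun k => abs (u k)) m
              <= sum_n (fun k => abs (u k)) m + abs (u (S m))).
      generalize (abs_ge_0 (u (S m))); lra.
Qed.

Lemma l1_norm_eq_zero (u : l1T) : l1_norm u = 0 -> u = zero.
Proof.
  intros h; apply l1_ext; intros n; apply abs_eq_zero.
  generalize (l1_norm_coord u n) (abs_ge_0 (u n)); lra.
Qed.

Lemma l1_norm_zero : l1_norm zero = 0.
Proof.
  unfold l1_norm; rewrite (Series_ext _ (fun n => 0 * 0)).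
  - rewrite Series_scal_l; ring.
  - intros n; rewrite Rmult_0_l; apply (@abs_zero (field F)).
Qed.

Lemma l1_norm_opp (u : l1T) : l1_norm (opp u) = l1_norm u.
Proof. apply Series_ext; intros n; apply (abs_opp (u n)). Qed.

Definition l1_ball (u : l1T) (e : R) (v : l1T) : Prop := l1_norm (minus v u) < e.

Lemma l1_ball_center (u : l1T) (e : posreal) : l1_ball u e u.
Proof.
  apply Rle_lt_trans with (l1_norm zero).
  - apply Req_le, f_equal; exact (@minus_eq_zero l1_AbelianGroup u).
  - rewrite l1_norm_zero; apply cond_pos.
Qed.

Lemma l1_ball_sym (u v : l1T) (e : R) : l1_ball u e v -> l1_ball v e u.
Proof. unfold l1_ball; now rewrite <- (opp_minus v u), l1_norm_opp. Qed.

Lemma l1_ball_triangle (u v w : l1T) (e1 e2 : R) :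
  l1_ball u e1 v -> l1_ball v e2 w -> l1_ball u (e1 + e2) w.
Proof.
  unfold l1_ball; intros h1 h2.
  rewrite (minus_trans v).
  eapply Rle_lt_trans; [apply l1_norm_triangle | lra].
Qed.

Definition l1_UniformSpace_mixin :=
  UniformSpace.Mixin l1T zero _ l1_ball_center l1_ball_sym l1_ball_triangle.

Canonical l1_UniformSpace := UniformSpace.Pack l1T l1_UniformSpace_mixin l1T.

Canonical l1_NormedModuleAux :=
  NormedModuleAux.Pack (field F) l1T
    (NormedModuleAux.Class (field F) l1T
       (ModuleSpace.class _ l1_ModuleSpace) l1_UniformSpace_mixin) l1T.

Lemma l1_norm_compat1 (u v : l1T) (e : R) : l1_norm (minus v u) < e -> ball u e v.
Proof. intros h; exact h. Qed.

Lemma l1_norm_compat2 (u v : l1T) (e : posreal) :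
  ball u e v -> l1_norm (minus v u) < 1 * e.
Proof. rewrite Rmult_1_l; intros h; exact h. Qed.

Definition l1_NormedModule_mixin :=
  NormedModule.Mixin (field F) l1_NormedModuleAux l1_norm 1
    l1_norm_triangle l1_norm_scal l1_norm_compat1 l1_norm_compat2
    l1_norm_eq_zero.

Canonical l1_NormedModule :=
  NormedModule.Pack (field F) l1T
    (NormedModule.Class (field F) l1T _ l1_NormedModule_mixin) l1T.

End EllOne.

Definition l1 (F : scalars) : NormedModule (field F) := l1_NormedModule F.

(* Main.v *)
From Stdlib Require Import Reals Lra Lia List Bool Classical ClassicalEpsilon Cantor.
From Stdlib Require Import FunctionalExtensionality PropExtensionality ProofIrrelevance.
From Coquelicot Require Import Coquelicot.
From mathcomp Require boolp classical_sets.
Require Import Defs.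

(** Suppose that some slice S(f, delta) has diameter at most [r < 2], and fix a
    point [x] of it with [norm x < 1].  If [x + z] and [x - z] both lie in the
    slice, then their distance [2 * norm z] is at most [r], so [norm z <= r / 2 < 1].
    Hence an operator T on the summable sequences that sends the basis vectors to
    points [x + z n] of this kind has essential norm at most [r / 2]: subtract the
    rank-one operator that sends every basis vector to [x].  If moreover the norms
    of the [x + z n] stay below 1 and tend to 1, then T and its adjoint have norm 1,
    while the adjoint maps a norm-one functional [g] to a sequence of norm
    sup |g (x + z n)|.  This is below 1 as soon as the values [g (x + z n)] are
    bounded away from 1 for large [n], which holds when [g (z n)] is eventually
    small because |g x| <= norm x < 1.  Then the adjoint misses its norm and the
    essential norm differs from the norm, contradicting the adjoint compact
    perturbation property ([not_ACPP_of_perturbations]).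

    To produce the [z n], one starts from vectors [w n] with norm bounded below
    on which every functional of the dual ball is eventually at most [eps]
    ([nearly_weakly_null_sequence]), and rescales them by the intermediate value
    theorem so that the larger of the norms of [x + t w] and [x - t w] takes a
    prescribed value below 1 ([symmetric_level]).  The norm of [w n] being at
    least 1/2, the factor [t] is at most 4, so a fixed small [eps] suffices.

    The vectors [w n] are consecutive differences of a subsequence of a
    1/2-separated sequence in the ball, and their existence is a quantitative form
    of Rosenthal's theorem.  The scalar disc is cut into finitely many cells of
    radius [rho].  For two far apart cells, Galvin's open Ramsey theorem gives the
    alternative of [independence_dichotomy]: along a subsequence, either any
    pattern of visits to the two cells is realised by some functional of the dual
    ball, or no functional visits both cells infinitely often.  The former yields a
    copy of the summable sequences ([independent_values_l1_copy]).  When it is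
    excluded for every pair, the values of each functional eventually vary by at
    most [7 * rho].  Working at one fixed scale avoids any diagonal argument over
    cells.

    That the adjoint of T has norm 1 rests on the Hahn-Banach theorem
    ([norming_functional]), proved with Zorn's lemma for real functionals and
    transferred to complex scalars. *)

(** * Ramsey theory of increasing sequences *)

Definition incr (phi : nat -> nat) : Prop := forall n, (phi n < phi (S n))%nat.

Lemma incr_lt (phi : nat -> nat) :
  incr phi -> forall i j, (i < j)%nat -> (phi i < phi j)%nat.
Proof.
  intros h i j hij; induction hij as [| j hij IH]; [apply h |].
  exact (Nat.lt_trans _ _ _ IH (h j)).
Qed.

Lemma incr_le_id (phi : nat -> nat) : incr phi -> forall n, (n <= phi n)%nat.
Proof.
  intros h n; induction n as [| n IH]; [lia | specialize (h n); lia].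
Qed.

Lemma incr_comp (phi psi : nat -> nat) :
  incr phi -> incr psi -> incr (fun n => phi (psi n)).
Proof. intros h1 h2 n; apply (incr_lt _ h1), h2. Qed.

(** Histories list the newest entry first, so that extending one is a [cons]. *)
Fixpoint play {A : Type} (h : list A) (m : nat -> A) (k : nat) : list A :=
  match k with O => h | S k => m k :: play h m k end.

Lemma play_length {A : Type} (m : nat -> A) (k : nat) : length (play nil m k) = k.
Proof. induction k as [| k IH]; simpl; auto. Qed.

Lemma play_in {A : Type} (m : nat -> A) (k i : nat) :
  (i < k)%nat -> In (m i) (play nil m k).
Proof.
  induction k as [| k IH]; intros hi; [lia | simpl].
  destruct (Nat.eq_dec i k) as [-> | hik]; [now left | right; apply IH; lia].
Qed.

Lemma play_shift {A : Type} (h : list A) (m : nat -> A) (k : nat) :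
  play (m 0%nat :: h) (fun n => m (S n)) k = play h m (S k).
Proof. induction k as [| k IH]; simpl; [reflexivity | now rewrite IH]. Qed.

(** Dependent choice in which each new term may depend on all earlier ones. *)
Lemma history_choice {A : Type} (P : list A -> A -> Prop) :
  (forall h, exists n, P h n) -> exists x : nat -> A, forall k, P (play nil x k) (x k).
Proof.
  intros hP.
  set (f := fun h => proj1_sig (constructive_indefinite_description _ (hP h))).
  set (H := fix H k := match k with O => nil | S k => f (H k) :: H k end).
  exists (fun k => f (H k)); intros k.
  replace (play nil (fun k => f (H k)) k) with (H k).
  - exact (proj2_sig (constructive_indefinite_description _ (hP (H k)))).
  - induction k as [| k IH]; simpl; [reflexivity | now rewrite <- IH].
Qed.

Lemma sequence_choice {A : Type} (Q : nat -> A -> Prop) :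
  (forall n, exists y, Q n y) -> exists u : nat -> A, forall n, Q n (u n).
Proof.
  intros hQ; destruct (history_choice (fun h : list A => Q (length h))) as [u hu].
  - intros h; apply hQ.
  - exists u; intros n; generalize (hu n); now rewrite play_length.
Qed.

Lemma history_bound (h : list nat) : exists N, forall a, In a h -> (a < N)%nat.
Proof.
  induction h as [| b h [N hN]]; [exists O; intros a [] |].
  exists (S (b + N)); intros a [-> | ha]; [lia | specialize (hN a ha); lia].
Qed.

Lemma increasing_choice (Q : nat -> nat -> Prop) :
  (forall k N, exists n, (N <= n)%nat /\ Q k n) ->
  exists x, incr x /\ forall k, Q k (x k).
Proof.
  intros hQ.
  destruct (history_choice (fun h n => (forall a, In a h -> (a < n)%nat) /\ Q (length h) n))
    as [x hx].
  - intros h; destruct (history_bound h) as [N hN].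
    destruct (hQ (length h) N) as [n [hn hq]].
    exists n; split; auto; intros a ha; specialize (hN a ha); lia.
  - exists x; split.
    + intros n; apply (proj1 (hx (S n))), play_in; lia.
    + intros k; generalize (proj2 (hx k)); now rewrite play_length.
Qed.

Definition infinite (X : nat -> Prop) : Prop :=
  forall N, exists n, (N <= n)%nat /\ X n.

Definition almost_included (X X' : nat -> Prop) : Prop :=
  exists N, forall n, (N <= n)%nat -> X n -> X' n.

Lemma almost_included_trans (X1 X2 X3 : nat -> Prop) :
  almost_included X1 X2 -> almost_included X2 X3 -> almost_included X1 X3.
Proof.
  intros [N h] [N' h']; exists (N + N')%nat; intros n hn hx.
  apply h'; [lia | apply h; [lia | exact hx]].
Qed.

(** [F] is a set of forbidden histories.  Only sequences that start late are
    tested: this makes acceptance insensitive to finite modifications of [X],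
    which is what lets a diagonal sequence inherit decisions from the sets it is
    almost included in. *)
Definition accepts (F : list nat -> Prop) (X : nat -> Prop) (h : list nat) : Prop :=
  exists N, forall m, incr m -> (forall k, X (m k)) -> (N <= m 0)%nat ->
  exists k, F (play h m k).

Definition rejects (F : list nat -> Prop) (X : nat -> Prop) (h : list nat) : Prop :=
  forall X', infinite X' -> almost_included X' X -> ~ accepts F X' h.

Lemma accepts_almost_included (F : list nat -> Prop) (X X' : nat -> Prop) (h : list nat) :
  almost_included X' X -> accepts F X h -> accepts F X' h.
Proof.
  intros [N0 hN0] [N hN]; exists (N + N0)%nat; intros m hm hX h0.
  apply hN; auto; [| lia].
  intros k; apply hN0; auto.
  destruct k as [| k]; [lia |].
  generalize (incr_lt _ hm 0 (S k)); lia.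
Qed.

Lemma rejects_almost_included (F : list nat -> Prop) (X X' : nat -> Prop) (h : list nat) :
  almost_included X' X -> rejects F X h -> rejects F X' h.
Proof.
  intros hXX hr Z hZ hZX; apply hr; auto.
  exact (almost_included_trans _ _ _ hZX hXX).
Qed.

Lemma accepts_or_rejects_subset (F : list nat -> Prop) (X : nat -> Prop) (h : list nat) :
  infinite X -> exists X', infinite X' /\ almost_included X' X /\
  (accepts F X' h \/ rejects F X' h).
Proof.
  intros hX; destruct (classic (rejects F X h)) as [hr | hr].
  - exists X; repeat split; auto; exists O; auto.
  - apply not_all_ex_not in hr; destruct hr as [X' hX'].
    exists X'; tauto.
Qed.

(** The code of a list is a pair of a recursion depth and nested Cantor codes; the
    depth makes the decoding structurally recursive. *)
Lemma list_enumeration : exists e : nat -> list nat, forall l, exists n, e n = l.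
Proof.
  set (decode := fix decode (fuel n : nat) : list nat :=
    match fuel, n with
    | S fuel, S n => fst (of_nat n) :: decode fuel (snd (of_nat n))
    | _, _ => nil
    end).
  exists (fun n => decode (fst (of_nat n)) (snd (of_nat n))); intros l.
  assert (H : exists fuel n, decode fuel n = l).
  { induction l as [| a l [fuel [n IH]]]; [exists O, O; reflexivity |].
    exists (S fuel), (S (to_nat (a, n))); change (fst (of_nat (to_nat (a, n))) ::
            decode fuel (snd (of_nat (to_nat (a, n)))) = a :: l).
    rewrite cancel_of_to; simpl; now rewrite IH. }
  destruct H as [fuel [n H]].
  exists (to_nat (fuel, n)); now rewrite cancel_of_to.
Qed.

(** A diagonal argument: shrink a set countably often, deciding one history at each
    stage, and take an increasing sequence that is almost included in all the
    stages. *)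
Lemma decisive_set (F : list nat -> Prop) :
  exists X, infinite X /\ forall h, accepts F X h \/ rejects F X h.
Proof.
  destruct list_enumeration as [e he].
  destruct (history_choice (fun (H : list (nat -> Prop)) X =>
      let X0 := match H with nil => fun _ => True | X0 :: _ => X0 end in
      infinite X0 -> infinite X /\ almost_included X X0 /\
      (accepts F X (e (length H)) \/ rejects F X (e (length H))))) as [D hD].
  { intros H; set (X0 := match H with nil => fun _ => True | X0 :: _ => X0 end).
    cbv zeta; fold X0.
    destruct (classic (infinite X0)) as [hi | hi].
    - destruct (accepts_or_rejects_subset F X0 (e (length H)) hi) as [X hX].
      exists X; intros _; exact hX.
    - exists X0; intros hi'; contradiction. }
  assert (hinf : forall k, infinite (D k)).
  { intros k; induction k as [| k IH].
    - apply (hD O); simpl; intros N; exists N; auto.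
    - apply (hD (S k)); exact IH. }
  assert (hsub : forall k j, almost_included (D (j + k)%nat) (D k)).
  { intros k j; induction j as [| j IH]; [exists O; auto |].
    apply almost_included_trans with (2 := IH).
    exact (proj1 (proj2 (hD (S (j + k)) (hinf (j + k)%nat)))). }
  destruct (increasing_choice
    (fun k n => forall i, (i <= k)%nat -> D i n)) as [x [hx hxD]].
  { intros k.
    assert (H : exists N, forall n, (N <= n)%nat -> D k n ->
                forall i, (i <= k)%nat -> D i n).
    { assert (H : forall j, exists N, forall n, (N <= n)%nat -> D k n ->
                  forall i, (i < j)%nat -> (i <= k)%nat -> D i n).
      { intros j; induction j as [| j [N IH]]; [exists O; intros; lia |].
        destruct (Compare_dec.le_lt_dec j k) as [hj | hj].
        - destruct (hsub j (k - j)%nat) as [N' hN'].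
          exists (N + N')%nat; intros n hn hk i hi hik.
          destruct (Nat.eq_dec i j) as [-> | hij].
          + apply hN'; [lia |]. replace (k - j + j)%nat with k by lia; exact hk.
          + apply IH; auto; lia.
        - exists N; intros n hn hk i hi hik; apply IH; auto; lia. }
      destruct (H (S k)) as [N hN]; exists N; intros n hn hk i hi.
      apply hN; auto; lia. }
    destruct H as [N0 hN0]; intros N.
    destruct (hinf k (N + N0)%nat) as [n [hn hDn]].
    exists n; split; [lia |]; intros i hi; apply hN0; auto; lia. }
  exists (fun n => exists k, n = x k); split.
  - intros N; exists (x N); split; [apply incr_le_id, hx | eauto].
  - intros h; destruct (he h) as [i <-].
    assert (hal : almost_included (fun n => exists k, n = x k) (D i)).
    { exists (x i); intros n hn [k ->]; apply hxD.
      destruct (Compare_dec.le_lt_dec i k) as [hik | hik]; [exact hik |].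
      generalize (incr_lt _ hx k i hik); lia. }
    assert (hdec : accepts F (D i) (e i) \/ rejects F (D i) (e i)).
    { rewrite <- (play_length D i) at 2 4.
      apply (hD i).
      destruct i as [| i]; simpl; [intros N; exists N; auto | apply hinf]. }
    destruct hdec as [ha | hr].
    + left; exact (accepts_almost_included _ _ _ _ hal ha).
    + right; exact (rejects_almost_included _ _ _ _ hal hr).
Qed.

(** If infinitely many one-step extensions of [h] were accepted, these extension
    points, thinned so that each exceeds the delays required by the previous ones,
    would form a set accepting [h]. *)
Lemma rejects_extension (F : list nat -> Prop) (X : nat -> Prop) (h : list nat) :
  infinite X -> (forall h, accepts F X h \/ rejects F X h) -> rejects F X h ->
  exists N, forall n, (N <= n)%nat -> X n -> rejects F X (n :: h).
Proof.
  intros hX hdec hr; apply NNPP; intros hno.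
  set (bounds := fun n N => forall m, incr m -> (forall k, X (m k)) ->
    (N <= m 0)%nat -> exists k, F (play (n :: h) m k)).
  assert (hacc : forall N, exists n, (N <= n)%nat /\ X n /\ exists b, bounds n b).
  { intros N; apply NNPP; intros hN; apply hno; exists N; intros n hn hx.
    destruct (hdec (n :: h)) as [ha | ha]; [| exact ha].
    destruct hN; exists n; auto. }
  assert (hb : exists b, forall n, (exists c, bounds n c) -> bounds n (b n)).
  { exists (fun n => epsilon (inhabits O) (bounds n)); intros n; apply epsilon_spec. }
  destruct hb as [b hb].
  destruct (history_choice (fun H n => (forall a, In a H -> (a < n)%nat /\ (b a <= n)%nat) /\
     X n /\ bounds n (b n))) as [x hx].
  { intros H.
    assert (hM : exists M, forall a, In a H -> (a < M)%nat /\ (b a <= M)%nat).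
    { induction H as [| a H [M IH]]; [exists O; intros a [] |].
      exists (S (a + b a + M)); intros c [-> | hc]; [lia | specialize (IH c hc); lia]. }
    destruct hM as [M hM].
    destruct (hacc M) as [n [hn [hXn hex]]]; exists n; split; [| auto].
    intros a ha; specialize (hM a ha); lia. }
  assert (hinc : incr x).
  { intros k; apply (proj1 (hx (S k))), play_in; lia. }
  apply (hr (fun n => exists k, n = x k)).
  - intros N; exists (x N); split; [apply incr_le_id, hinc | eauto].
  - exists O; intros n _ [k ->]; apply hx.
  - exists O; intros m hm hXm _.
    destruct (hXm O) as [i hi].
    assert (H : exists k, F (play (x i :: h) (fun n => m (S n)) k)).
    { apply (proj2 (proj2 (hx i))).
      - intros k; apply hm.
      - intros k; destruct (hXm (S k)) as [j ->]; apply hx.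
      - destruct (hXm 1%nat) as [j hj]; rewrite hj.
        apply (proj1 (hx j)), play_in.
        generalize (hm O); rewrite hi, hj; intros hij.
        destruct (Compare_dec.le_lt_dec j i) as [hji | hji]; [| exact hji].
        destruct (Nat.eq_dec j i) as [-> | hne]; [lia |].
        generalize (incr_lt _ hinc j i); lia. }
    destruct H as [k hk]; exists (S k).
    rewrite <- play_shift, hi; exact hk.
Qed.

Fixpoint sublists (l : list nat) : list (list nat) :=
  match l with nil => nil :: nil | a :: l => sublists l ++ map (cons a) (sublists l) end.

Lemma sublists_skip (a : nat) (l s : list nat) :
  In s (sublists l) -> In s (sublists (a :: l)).
Proof. intros h; apply in_or_app; now left. Qed.

Lemma sublists_keep (a : nat) (l s : list nat) :
  In s (sublists l) -> In (a :: s) (sublists (a :: l)).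
Proof. intros h; apply in_or_app; right; now apply in_map. Qed.

(** Galvin's open Ramsey theorem.  On a decisive set, either the empty history is
    accepted, or it is rejected and [rejects_extension] allows one to pick terms one
    by one so that all histories drawn from them remain rejected; a rejected history
    is not forbidden. *)
Lemma galvin_dichotomy (F : list nat -> Prop) :
  exists y, incr y /\
  ((forall psi, incr psi -> exists k, F (play nil (fun i => y (psi i)) k)) \/
   (forall k s, In s (sublists (play nil y k)) -> ~ F s)).
Proof.
  destruct (decisive_set F) as [X [hX hdec]].
  destruct (hdec nil) as [[N hN] | hr].
  - destruct (increasing_choice (fun _ n => X n /\ (N <= n)%nat)) as [y [hy hXy]].
    { intros _ M; destruct (hX (M + N)%nat) as [n [hn hXn]].
      exists n; repeat split; auto; lia. }
    exists y; split; [exact hy | left]; intros psi hpsi.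
    apply hN; [exact (incr_comp _ _ hy hpsi) | |]; [intros k |]; apply hXy.
  - destruct (history_choice (fun H n => X n /\ (forall a, In a H -> (a < n)%nat) /\
       forall s, In s (sublists H) -> rejects F X s -> rejects F X (n :: s))) as [y hy].
    { intros H.
      assert (hM : exists M, forall s, In s (sublists H) -> rejects F X s ->
                forall n, (M <= n)%nat -> X n -> rejects F X (n :: s)).
      { induction (sublists H) as [| t L [M IH]]; [exists O; intros s [] |].
        destruct (classic (rejects F X t)) as [ht | ht].
        - destruct (rejects_extension F X t hX hdec ht) as [M' hM'].
          exists (M + M')%nat; intros s [-> | hs] hrs n hn hXn.
          + apply hM'; auto; lia.
          + apply IH; auto; lia.
        - exists M; intros s [-> | hs] hrs; [contradiction | now apply IH]. }
      destruct hM as [M hM]; destruct (history_bound H) as [M' hM'].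
      destruct (hX (M + M')%nat) as [n [hn hXn]].
      exists n; repeat split; auto.
      - intros a ha; specialize (hM' a ha); lia.
      - intros s hs hrs; apply hM; auto; lia. }
    exists y; split; [intros k; apply (hy (S k)), play_in; lia | right].
    assert (hrej : forall k s, In s (sublists (play nil y k)) -> rejects F X s).
    { intros k; induction k as [| k IH]; intros s hs.
      - destruct hs as [<- | []]; exact hr.
      - apply in_app_or in hs; destruct hs as [hs | hs]; [now apply IH |].
        apply in_map_iff in hs; destruct hs as [t [<- ht]].
        apply (hy k); auto. }
    intros k s hs hF; apply (hrej k s hs X hX); [exists O; auto |].
    exists O; intros m _ _ _; exists O; exact hF.
Qed.

(** The point [s] lies in [A] at the entries of even position and in [B] at those of
    odd position, positions being counted from the oldest entry. *)
Fixpoint alternates {W : Type} (A B : nat -> W -> Prop) (h : list nat) (s : W) : Prop :=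
  match h with
  | nil => True
  | n :: h => (if Nat.even (length h) then A n s else B n s) /\ alternates A B h s
  end.

(** The combinatorial core of Rosenthal's theorem: apply [galvin_dichotomy] to the
    histories along which no point alternates.  In the first case of Galvin's theorem no
    point meets both [A] and [B] infinitely often, since it would alternate along a
    subsequence.  In the second case every finite set of indices can be
    followed alternately, and inserting spare indices turns alternation into an
    arbitrary pattern. *)
Lemma independence_dichotomy {W : Type} (A B : nat -> W -> Prop) :
  (exists phi, incr phi /\ forall (sigma : nat -> bool) N, exists s,
     forall k, (k < N)%nat -> if sigma k then A (phi k) s else B (phi k) s) \/
  (exists phi, incr phi /\ forall s,
     ~ (infinite (fun k => A (phi k) s) /\ infinite (fun k => B (phi k) s))).
Proof.
  destruct (galvin_dichotomy (fun h => ~ exists s, alternates A B h s))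
    as [y [hy [hbad | hgood]]].
  - right; exists y; split; [exact hy |]; intros s [hA hB].
    destruct (increasing_choice (fun k n =>
      if Nat.even k then A (y n) s else B (y n) s)) as [psi [hpsi hs]].
    { intros k; destruct (Nat.even k); [apply hA | apply hB]. }
    destruct (hbad psi hpsi) as [k hk]; apply hk; exists s.
    clear hk; induction k as [| k IH]; simpl; [exact I |].
    rewrite play_length; split; [apply hs | exact IH].
  (* Odd terms carry the pattern; the even term before one is inserted exactly when
     the parity of its position has to be corrected. *)
  - left; exists (fun k => y (2 * k + 1)%nat); split.
    { intros n; apply (incr_lt _ hy); lia. }
    intros sigma N.
    set (L := fix L k := match k with
      | O => nil
      | S k =>
        if Bool.eqb (Nat.even (length (L k))) (sigma k) then y (2 * k + 1)%nat :: L k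
        else y (2 * k + 1)%nat :: y (2 * k)%nat :: L k
      end).
    assert (hL : forall k, In (L k) (sublists (play nil y (2 * k)))).
    { intros k; induction k as [| k IH]; [now left |].
      replace (2 * S k)%nat with (S (S (2 * k))) by lia.
      change (In (L (S k))
        (sublists (y (S (2 * k)) :: y (2 * k)%nat :: play nil y (2 * k)))).
      replace (S (2 * k)) with (2 * k + 1)%nat by lia.
      change (L (S k)) with
        (if Bool.eqb (Nat.even (length (L k))) (sigma k) then y (2 * k + 1)%nat :: L k
         else y (2 * k + 1)%nat :: y (2 * k)%nat :: L k).
      destruct (Bool.eqb (Nat.even (length (L k))) (sigma k)).
      - apply sublists_keep, sublists_skip, IH.
      - apply sublists_keep, sublists_keep, IH. }
    destruct (NNPP _ (hgood _ _ (hL N))) as [s hs]; exists s.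
    clear hL; induction N as [| N IH]; intros k hk; [lia |].
    change (L (S N)) with
        (if Bool.eqb (Nat.even (length (L N))) (sigma N) then y (2 * N + 1)%nat :: L N
         else y (2 * N + 1)%nat :: y (2 * N)%nat :: L N) in hs.
    assert (H : (if sigma N then A (y (2 * N + 1)%nat) s else B (y (2 * N + 1)%nat) s)
                /\ alternates A B (L N) s).
    { destruct (Bool.eqb (Nat.even (length (L N))) (sigma N)) eqn:E.
      - apply Bool.eqb_prop in E; rewrite <- E; exact hs.
      - apply Bool.eqb_false_iff in E.
        destruct hs as [h1 [_ h2]]; split; [| exact h2].
        revert h1; change (length (y (2 * N)%nat :: L N)) with (S (length (L N))).
        rewrite Nat.even_succ, <- Nat.negb_even.
        destruct (Nat.even (length (L N))), (sigma N); simpl; auto; congruence. }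
    destruct (Nat.eq_dec k N) as [-> | hkN]; [apply H | apply IH; [apply H | lia]].
Qed.

(** * Scalars and norms *)

Lemma abs_mult_eq (F : scalars) (a b : field F) : abs (mult a b) = abs a * abs b.
Proof. destruct F; [exact (Rabs_mult a b) | exact (Cmod_mult a b)]. Qed.

Lemma re_plus (F : scalars) (a b : field F) : re (plus a b) = re a + re b.
Proof. destruct F; reflexivity. Qed.

Lemma re_opp (F : scalars) (a : field F) : re (opp a) = - re a.
Proof. destruct F; reflexivity. Qed.

Lemma re_le_abs (F : scalars) (a : field F) : Rabs (re a) <= abs a.
Proof. destruct F; [apply Rle_refl | exact (re_le_Cmod a)]. Qed.

Lemma re_of_R_mult (F : scalars) (t : R) (a : field F) :
  re (mult (of_R F t) a) = t * re a.
Proof.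
  destruct F; [reflexivity |].
  change (t * fst a - 0 * snd a = t * fst a); ring.
Qed.

Lemma abs_rotation (F : scalars) (a : field F) :
  exists u : field F, abs u <= 1 /\ re (mult u a) = abs a.
Proof.
  destruct F.
  - destruct (Rle_dec 0 a) as [h | h].
    + exists 1; split; [change (Rabs 1 <= 1); rewrite Rabs_R1; lra |].
      change (1 * a = Rabs a); rewrite Rabs_pos_eq; lra.
    + exists (-1); split; [change (Rabs (-1) <= 1); rewrite (Rabs_left (-1)); lra |].
      change (-1 * a = Rabs a); rewrite Rabs_left; lra.
  - destruct (Req_dec (Cmod a) 0) as [h | h].
    + exists zero; split; [change (Cmod 0 <= 1); rewrite Cmod_0; lra |].
      change (0 * fst a - 0 * snd a = Cmod a); rewrite h; ring.
    + exists ((Cconj a / Cmod a)%C); split.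
      * change (Cmod (Cconj a / Cmod a) <= 1).
        rewrite Cmod_div by (intros E; apply h; injection E; auto).
        rewrite Cmod_R, Rabs_pos_eq by apply Cmod_ge_0.
        replace (Cmod (Cconj a)) with (Cmod a).
        -- unfold Rdiv; rewrite Rinv_r; lra.
        -- unfold Cmod, Cconj; simpl; f_equal; ring.
      * change (Re ((Cconj a / Cmod a) * a)%C = Cmod a).
        replace ((Cconj a / Cmod a) * a)%C with (RtoC (Cmod a)); [reflexivity |].
        assert (hC : RtoC (Cmod a) <> 0) by (intros E; apply h; injection E; auto).
        assert (E : Cmult (Cconj a) a = RtoC (Cmod a * Cmod a)).
        { replace (Cmod a * Cmod a) with (fst a * fst a + snd a * snd a).
          - destruct a as [p q]; unfold Cmult, Cconj, RtoC; simpl; f_equal; ring.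
          - unfold Cmod; rewrite sqrt_sqrt; [ring |].
            generalize (Rle_0_sqr (fst a)) (Rle_0_sqr (snd a)); unfold Rsqr; simpl; lra. }
        rewrite RtoC_mult in E.
        transitivity (Cdiv (Cmult (Cconj a) a) (RtoC (Cmod a))); [| field; exact hC].
        rewrite E; field; exact hC.
Qed.

(** With [j = -i] in the complex case, the second real part is the imaginary part.
    Estimates on real parts thus control absolute values in both fields at once. *)
Lemma abs_le_two_re (F : scalars) :
  exists j : field F, abs j <= 1 /\
  forall a : field F, abs a <= Rabs (re a) + Rabs (re (mult j a)).
Proof.
  destruct F.
  - exists 1; split; [change (Rabs 1 <= 1); rewrite Rabs_R1; lra |].
    intros a; change (Rabs a <= Rabs a + Rabs (1 * a)).
    generalize (Rabs_pos (1 * a)); lra.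
  - exists (Copp Ci); split.
    + change (Cmod (- Ci) <= 1); rewrite Cmod_opp, Cmod_Ci; lra.
    + intros a; change (Cmod a <= Rabs (Re a) + Rabs (- 0 * fst a - - (1) * snd a)).
      replace (- 0 * fst a - - (1) * snd a) with (snd a) by ring.
      unfold Cmod; apply Rsqr_incr_0_var.
      * rewrite Rsqr_sqrt.
        -- unfold Re; generalize (Rabs_pos (fst a)) (Rabs_pos (snd a)).
           rewrite <- (pow2_abs (fst a)), <- (pow2_abs (snd a)).
           unfold Rsqr; nra.
        -- generalize (pow2_ge_0 (fst a)) (pow2_ge_0 (snd a)); lra.
      * generalize (Rabs_pos (Re a)) (Rabs_pos (snd a)); lra.
Qed.

Lemma interval_grid (rho : R) : 0 < rho -> exists L : list R,
  forall t, Rabs t <= 1 -> exists c, In c L /\ Rabs (t - c) <= rho.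
Proof.
  intros hrho.
  assert (H : forall n, exists L : list R, forall t, -1 <= t <= -1 + INR n * rho ->
     exists c, In c L /\ Rabs (t - c) <= rho).
  { intros n; induction n as [| n [L IH]].
    - exists (-1 :: nil); intros t ht; exists (-1); split; [now left |].
      simpl in ht; rewrite Rmult_0_l in ht.
      replace (t - -1) with 0 by lra; rewrite Rabs_R0; lra.
    - exists (-1 + INR n * rho :: L); intros t ht; rewrite S_INR in ht.
      destruct (Rle_dec t (-1 + INR n * rho)) as [h | h].
      + destruct (IH t) as [c [hc ht']]; [lra |]; exists c; split; [now right | auto].
      + exists (-1 + INR n * rho); split; [now left |].
        apply Rabs_le; lra. }
  destruct (nfloor_ex (2 / rho)) as [n [_ hn]].
  { apply Rlt_le, Rdiv_lt_0_compat; lra. }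
  destruct (H (S n)) as [L hL]; exists L; intros t ht; apply hL.
  apply Rabs_le_between in ht; split; [lra |].
  rewrite S_INR; apply Rlt_le in hn.
  apply (Rmult_le_compat_r rho) in hn; [| lra].
  replace (2 / rho * rho) with 2 in hn by (field; lra); lra.
Qed.

Lemma field_grid (F : scalars) (rho : R) : 0 < rho -> exists L : list (field F),
  forall a : field F, abs a <= 1 -> exists c, In c L /\ abs (minus a c) <= rho.
Proof.
  intros hrho; destruct F.
  - destruct (interval_grid rho hrho) as [L hL]; exists L; exact hL.
  - destruct (interval_grid (rho / 2)) as [L hL]; [lra |].
    exists (list_prod L L); intros a ha.
    generalize (Cmod_2Rmax a) (Rmax_Cmod a); intros _ hmax.
    assert (ha' : Cmod a <= 1) by exact ha.
    destruct (hL (fst a)) as [c [hc h1]].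
    { apply Rle_trans with (2 := ha'), Rle_trans with (2 := hmax), Rmax_l. }
    destruct (hL (snd a)) as [d [hd h2]].
    { apply Rle_trans with (2 := ha'), Rle_trans with (2 := hmax), Rmax_r. }
    exists (c, d); split; [now apply in_prod |].
    change (Cmod (fst a - c, snd a - d) <= rho).
    replace (fst a - c, snd a - d) with (Cplus (RtoC (fst a - c)) (Cmult Ci (RtoC (snd a - d)))).
    + eapply Rle_trans; [apply Cmod_triangle |].
      rewrite Cmod_mult, Cmod_Ci, !Cmod_R; lra.
    + unfold Cplus, Cmult, Ci, RtoC; simpl; f_equal; ring.
Qed.

Lemma bounded_real_subsequence (u : nat -> R) (M : R) :
  (forall n, Rabs (u n) <= M) -> exists phi l, incr phi /\
  forall eps, 0 < eps -> exists N, forall n, (N <= n)%nat -> Rabs (u (phi n) - l) < eps.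
Proof.
  intros hu.
  destruct (Bolzano_Weierstrass u (fun x => - M <= x <= M)) as [l hl].
  { apply compact_P3. }
  { intros n; apply Rabs_le_between, hu. }
  destruct (increasing_choice (fun k n => Rabs (u n - l) < / INR (S k))) as [phi [hphi hlim]].
  { intros k N.
    assert (hk : 0 < / INR (S k)) by (apply Rinv_0_lt_compat, lt_0_INR; lia).
    apply (hl (fun x => Rabs (x - l) < / INR (S k))).
    exists (mkposreal _ hk); intros x hx; exact hx. }
  exists phi, l; split; [exact hphi |]; intros eps heps.
  destruct (archimed_cor1 eps heps) as [N [hN hN0]].
  exists N; intros n hn; apply Rlt_le_trans with (1 := hlim n).
  apply Rle_trans with (2 := Rlt_le _ _ hN).
  apply Rinv_le_contravar; [now apply lt_0_INR | apply le_INR; lia].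
Qed.

Lemma bounded_scalar_subsequence (F : scalars) (a : nat -> field F) (M : R) :
  (forall n, abs (a n) <= M) -> exists phi l, incr phi /\
  forall eps, 0 < eps -> exists N, forall n, (N <= n)%nat ->
  abs (minus (a (phi n)) l) < eps.
Proof.
  intros ha; destruct F; [exact (bounded_real_subsequence a M ha) |].
  assert (hmax : forall n, Rmax (Rabs (fst (a n))) (Rabs (snd (a n))) <= M).
  { intros n; apply Rle_trans with (1 := Rmax_Cmod _), ha. }
  destruct (bounded_real_subsequence (fun n => fst (a n)) M) as [phi [p [hphi hp]]].
  { intros n; apply Rle_trans with (2 := hmax n), Rmax_l. }
  destruct (bounded_real_subsequence (fun n => snd (a (phi n))) M) as [psi [q [hpsi hq]]].
  { intros n; apply Rle_trans with (2 := hmax (phi n)), Rmax_r. }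
  exists (fun n => phi (psi n)), (p, q); split; [now apply incr_comp |].
  intros eps heps.
  destruct (hp (eps / 2)) as [N hN]; [lra |].
  destruct (hq (eps / 2)) as [N' hN']; [lra |].
  exists (N + N')%nat; intros n hn.
  set (b := a (phi (psi n))).
  change (Cmod (fst b - p, snd b - q) < eps).
  replace (fst b - p, snd b - q) with (Cplus (RtoC (fst b - p)) (Cmult Ci (RtoC (snd b - q)))).
  - eapply Rle_lt_trans; [apply Cmod_triangle |].
    rewrite Cmod_mult, Cmod_Ci, !Cmod_R.
    generalize (hN (psi n)) (hN' n); intros h1 h2.
    specialize (h2 ltac:(lia)).
    assert (h1' : Rabs (fst b - p) < eps / 2).
    { apply h1; generalize (incr_le_id _ hpsi n); lia. }
    unfold b in *; lra.
  - unfold Cplus, Cmult, Ci, RtoC; simpl; f_equal; ring.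
Qed.

Lemma norm_scal_of_R (F : scalars) (Y : NormedModule (field F)) (t : R) (y : Y) :
  norm (scal (of_R F t) y) = Rabs t * norm y.
Proof.
  assert (hle : forall s (z : Y), norm (scal (of_R F s) z) <= Rabs s * norm z).
  { intros s z; rewrite <- (abs_of_R F s); apply norm_scal. }
  apply Rle_antisym; [apply hle |].
  destruct (Req_dec t 0) as [-> | ht].
  - rewrite Rabs_R0, Rmult_0_l; apply norm_ge_0.
  - assert (E : y = scal (of_R F (/ t)) (scal (of_R F t) y)).
    { rewrite scal_assoc, of_R_mult, Rinv_l, of_R_one, scal_one; auto. }
    rewrite E at 1.
    apply Rle_trans with (Rabs t * (Rabs (/ t) * norm (scal (of_R F t) y))).
    + apply Rmult_le_compat_l; [apply Rabs_pos | apply hle].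
    + rewrite <- Rmult_assoc, <- Rabs_mult, Rinv_r, Rabs_R1; [lra | exact ht].
Qed.

Lemma bop_minus (F : scalars) (X Y : NormedModule (field F)) (T : bop X Y) (x y : X) :
  T (minus x y) = minus (T x) (T y).
Proof.
  unfold minus; rewrite (linear_plus _ (bop_linear T)).
  f_equal; apply (linear_opp _ y (bop_linear T)).
Qed.

Lemma bop_sum_n (F : scalars) (X Y : NormedModule (field F)) (T : bop X Y)
  (u : nat -> X) (N : nat) :
  T (sum_n u N) = sum_n (fun k => T (u k)) N.
Proof.
  induction N as [| N IH]; [now rewrite !sum_O |].
  rewrite !sum_Sn, (linear_plus _ (bop_linear T)); now f_equal.
Qed.

Lemma dual_ball_le (F : scalars) (Y : NormedModule (field F)) (g : dual Y) (y : Y) :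
  norm g <= 1 -> abs (g y) <= norm y.
Proof.
  intros hg; apply Rle_trans with (1 := op_norm_bound g y).
  generalize (norm_ge_0 y); change (op_norm g <= 1) in hg; nra.
Qed.

Lemma filterlim_norm_minus (F : scalars) (Y : NormedModule (field F)) (u : nat -> Y) (l : Y) :
  filterlim u eventually (locally l) <->
  forall eps, 0 < eps -> exists N, forall n, (N <= n)%nat -> norm (minus (u n) l) < eps.
Proof.
  rewrite filterlim_locally; split.
  - intros H eps heps.
    assert (hf : 0 < eps / @norm_factor _ Y).
    { apply Rdiv_lt_0_compat; [lra | apply norm_factor_gt_0]. }
    destruct (H (mkposreal _ hf)) as [N hN]; exists N; intros n hn.
    apply Rlt_le_trans with (1 := norm_compat2 _ _ _ (hN n hn)); simpl.
    apply Req_le; field; apply Rgt_not_eq, norm_factor_gt_0.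
  - intros H eps; destruct (H eps (cond_pos eps)) as [N hN].
    exists N; intros n hn; apply norm_compat1, hN, hn.
Qed.

Lemma norm_minus_sym (F : scalars) (Y : NormedModule (field F)) (x y : Y) :
  norm (@minus Y x y) = norm (@minus Y y x).
Proof.
  transitivity (norm (@opp Y (@minus Y x y))); [symmetry; apply norm_opp |].
  f_equal; exact (@opp_minus Y x y).
Qed.

Lemma norm_minus_le (F : scalars) (Y : NormedModule (field F)) (x y : Y) :
  norm (@minus Y x y) <= norm x + norm y.
Proof. rewrite <- (norm_opp y); apply norm_triangle. Qed.

(** * Norming functionals *)

(** A real-linear functional of norm at most 1 on a subspace, norming [y0], given by
    its graph.  Single-valuedness is a consequence: if the graph contains
    [(zero, r)], it contains all its multiples, and the bound forces [r = 0]. *)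
Record norming_graph (F : scalars) (Y : NormedModule (field F)) (y0 : Y)
  (G : Y * R -> Prop) : Prop :=
  { graph_base : G (y0, norm y0);
    graph_plus : forall y z r s, G (y, r) -> G (z, s) -> G (plus y z, r + s);
    graph_scal : forall t y r, G (y, r) -> G (scal (of_R F t) y, t * r);
    graph_le : forall y r, G (y, r) -> r <= norm y }.

Lemma scal_of_R_plus (F : scalars) (Y : NormedModule (field F)) (s t : R) (y : Y) :
  scal (of_R F (s + t)) y = @plus Y (scal (of_R F s) y) (scal (of_R F t) y).
Proof.
  rewrite <- (@scal_distr_r (field F) Y); f_equal.
  destruct F; [reflexivity | exact (RtoC_plus s t)].
Qed.

Lemma scal_of_R_mult (F : scalars) (Y : NormedModule (field F)) (s t : R) (y : Y) :
  scal (of_R F s) (scal (of_R F t) y) = scal (of_R F (s * t)) y.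
Proof. now rewrite scal_assoc, of_R_mult. Qed.

Lemma scal_of_R_1 (F : scalars) (Y : NormedModule (field F)) (y : Y) :
  scal (of_R F 1) y = y.
Proof. rewrite of_R_one; apply scal_one. Qed.

Lemma scal_of_R_0 (F : scalars) (Y : NormedModule (field F)) (y : Y) :
  scal (of_R F 0) y = zero.
Proof.
  apply norm_eq_zero; rewrite norm_scal_of_R, Rabs_R0; ring.
Qed.

Lemma plus_swap (G : AbelianMonoid) (a b c d : G) :
  plus (plus a b) (plus c d) = plus (plus a c) (plus b d).
Proof.
  rewrite <- !plus_assoc; f_equal; rewrite !plus_assoc; f_equal; apply plus_comm.
Qed.

(** The one-dimensional Hahn-Banach step.  The value [alpha] at the new vector [v] is
    the supremum of the lower bounds [r - norm (z - v)], which lies below every upper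
    bound [norm (z + v) - r] by the triangle inequality. *)
Lemma graph_extend (F : scalars) (Y : NormedModule (field F)) (y0 : Y) G (v : Y) :
  norming_graph F Y y0 G -> exists G' alpha, norming_graph F Y y0 G' /\
  (forall p, G p -> G' p) /\ G' (v, alpha).
Proof.
  intros hG.
  assert (h0 : G (zero, 0)).
  { generalize (graph_scal _ _ _ _ hG 0 _ _ (graph_base _ _ _ _ hG)).
    now rewrite scal_of_R_0, Rmult_0_l. }
  set (E := fun b => exists z r, G (z, r) /\ b = r - norm (minus z v)).
  assert (hEub : forall z r, G (z, r) -> is_upper_bound E (norm (plus z v) - r)).
  { intros z r hz b [z' [r' [hz' ->]]].
    generalize (graph_le _ _ _ _ hG _ _ (graph_plus _ _ _ _ hG _ _ _ _ hz hz')).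
    replace (plus z z') with (plus (plus z v) (minus z' v)).
    - generalize (norm_triangle (plus z v) (minus z' v)); lra.
    - unfold minus; rewrite plus_swap.
      transitivity (plus (plus z z') zero); [f_equal; exact (@plus_opp_r Y v) | apply plus_zero_r]. }
  destruct (completeness E) as [alpha [hub hleast]].
  { eexists; exact (hEub _ _ h0). }
  { eexists; exists zero, 0; split; [exact h0 | reflexivity]. }
  exists (fun p => exists z r t, G (z, r) /\
    p = (plus z (scal (of_R F t) v), r + t * alpha)), alpha.
  split; [split |split].
  - exists y0, (norm y0), 0; split; [apply hG |].
    rewrite scal_of_R_0, plus_zero_r; f_equal; ring.
  - intros y z r s [y1 [r1 [t1 [h1 e1]]]] [y2 [r2 [t2 [h2 e2]]]].
    injection e1 as -> ->; injection e2 as -> ->.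
    exists (plus y1 y2), (r1 + r2), (t1 + t2); split; [now apply (graph_plus _ _ _ _ hG) |].
    rewrite scal_of_R_plus, plus_swap; f_equal; ring.
  - intros t y r [y1 [r1 [t1 [h1 e1]]]]; injection e1 as -> ->.
    exists (scal (of_R F t) y1), (t * r1), (t * t1); split; [now apply (graph_scal _ _ _ _ hG) |].
    rewrite (@scal_distr_l (field F) Y), scal_of_R_mult; f_equal; ring.
  - intros y r [z [r1 [t [h1 e1]]]]; injection e1 as -> ->.
    destruct (Rtotal_order t 0) as [ht | [-> | ht]].
    + set (z' := scal (of_R F (/ - t)) z).
      assert (hz : z = scal (of_R F (- t)) z').
      { unfold z'; rewrite scal_of_R_mult, Rinv_r, scal_of_R_1; [reflexivity | lra]. }
      assert (H : / - t * r1 - norm (minus z' v) <= alpha).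
      { apply hub; exists z', (/ - t * r1); split; [| reflexivity].
        now apply (graph_scal _ _ _ _ hG). }
      replace (plus z (scal (of_R F t) v)) with (scal (of_R F (- t)) (minus z' v)).
      * rewrite norm_scal_of_R, Rabs_pos_eq by lra.
        apply (Rmult_le_compat_l (- t)) in H; [| lra].
        replace (- t * (/ - t * r1 - norm (minus z' v))) with
          (r1 - - t * norm (minus z' v)) in H by (field; lra).
        lra.
      * unfold minus; rewrite (@scal_distr_l (field F) Y), <- hz; f_equal.
        rewrite (@scal_opp_r (field F) Y).
        replace t with (- t * -1) at 2 by ring.
        rewrite <- scal_of_R_mult.
        rewrite <- (@scal_opp_r (field F) Y); f_equal.
        rewrite <- (scal_opp_one v); f_equal.
        destruct F; [reflexivity | symmetry; exact (RtoC_opp 1)].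
    + rewrite scal_of_R_0, plus_zero_r, Rmult_0_l, Rplus_0_r.
      now apply (graph_le _ _ _ _ hG).
    + set (z' := scal (of_R F (/ t)) z).
      assert (hz : z = scal (of_R F t) z').
      { unfold z'; rewrite scal_of_R_mult, Rinv_r, scal_of_R_1; [reflexivity | lra]. }
      assert (H : alpha <= norm (plus z' v) - / t * r1).
      { apply hleast, hEub; now apply (graph_scal _ _ _ _ hG). }
      rewrite hz, <- (@scal_distr_l (field F) Y), norm_scal_of_R, Rabs_pos_eq by lra.
      apply (Rmult_le_compat_l t) in H; [| lra].
      replace (t * (norm (plus z' v) - / t * r1)) with (t * norm (plus z' v) - r1) in H
        by (field; lra).
      lra.
  - intros [y r] hy; exists y, r, 0; split; [exact hy |].
    rewrite scal_of_R_0, plus_zero_r; f_equal; ring.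
  - exists zero, 0, 1; split; [exact h0 |].
    rewrite scal_of_R_1, plus_zero_l; f_equal; ring.
Qed.

Lemma norming_real_functional (F : scalars) (Y : NormedModule (field F)) (y0 : Y) :
  exists G : Y -> R,
  (forall y z, G (plus y z) = G y + G z) /\
  (forall t y, G (scal (of_R F t) y) = t * G y) /\
  (forall y, G y <= norm y) /\ G y0 = norm y0.
Proof.
  set (T := {G : Y * R -> Prop | norming_graph F Y y0 G}).
  set (incl := fun G H : T => forall p, proj1_sig G p -> proj1_sig H p).
  assert (hline : norming_graph F Y y0
    (fun p => exists t, p = (scal (of_R F t) y0, t * norm y0))).
  { split.
    - exists 1; rewrite scal_of_R_1; f_equal; ring.
    - intros y z r s [t e] [t' e']; injection e as -> ->; injection e' as -> ->.
      exists (t + t'); rewrite scal_of_R_plus; f_equal; ring.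
    - intros s y r [t e]; injection e as -> ->; exists (s * t).
      rewrite scal_of_R_mult; f_equal; ring.
    - intros y r [t e]; injection e as -> ->; rewrite norm_scal_of_R.
      apply Rmult_le_compat_r; [apply norm_ge_0 | apply Rle_abs]. }
  destruct (@classical_sets.Zorn T (fun G H => boolp.asbool (incl G H))) as [[M hM] hmax].
  - intros G; apply boolp.asboolT; intros p hp; exact hp.
  - intros G H K h1 h2; apply boolp.asboolW in h1; apply boolp.asboolW in h2.
    apply boolp.asboolT; intros p hp; apply h2, h1, hp.
  - intros [G hG] [H hH] h1 h2; apply boolp.asboolW in h1; apply boolp.asboolW in h2.
    assert (E : G = H).
    { apply functional_extensionality; intros p; apply propositional_extensionality.
      split; [apply h1 | apply h2]. }
    subst H; f_equal; apply proof_irrelevance.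
  - intros A hA.
    assert (htot : forall G H, A G -> A H -> incl G H \/ incl H G).
    { intros G H hG hH; destruct (hA G H hG hH) as [h | h]; apply boolp.asboolW in h; auto. }
    destruct (classic (exists G, A G)) as [[G0 hG0] | hno].
    + assert (hU : norming_graph F Y y0 (fun p => exists G, A G /\ proj1_sig G p)).
      { split.
        - exists G0; split; [exact hG0 | apply (proj2_sig G0)].
        - intros y z r s [G [hG h1]] [H [hH h2]].
          destruct (htot G H hG hH) as [h | h].
          + exists H; split; [exact hH | apply (proj2_sig H); [apply h, h1 | exact h2]].
          + exists G; split; [exact hG | apply (proj2_sig G); [exact h1 | apply h, h2]].
        - intros t y r [G [hG h1]]; exists G; split; [exact hG | now apply (proj2_sig G)].
        - intros y r [G [hG h1]]; now apply (proj2_sig G). }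
      exists (exist _ _ hU); intros G hG; apply boolp.asboolT.
      intros p hp; exists G; auto.
    + exists (exist _ _ hline); intros G hG; destruct hno; eauto.
  - assert (htotal : forall y, exists r, M (y, r)).
    { intros y; destruct (graph_extend _ _ _ _ y hM) as [G' [alpha [hG' [hsub hy]]]].
      exists alpha.
      assert (E : exist _ _ hG' = (exist _ _ hM : T)).
      { apply hmax, boolp.asboolT; exact hsub. }
      injection E as E; rewrite <- E; exact hy. }
    assert (huniq : forall y r s, M (y, r) -> M (y, s) -> r = s).
    { assert (hle : forall y r s, M (y, r) -> M (y, s) -> r <= s).
      { intros y r s hr hs.
        generalize (graph_le _ _ _ _ hM _ _
          (graph_plus _ _ _ _ hM _ _ _ _ hr (graph_scal _ _ _ _ hM (-1) _ _ hs))).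
        replace (@plus Y y (scal (of_R F (-1)) y)) with (@zero Y).
        - rewrite norm_zero; lra.
        - transitivity (@plus Y (scal (of_R F 1) y) (scal (of_R F (-1)) y)).
          + rewrite <- scal_of_R_plus; replace (1 + -1) with 0 by ring.
            symmetry; apply scal_of_R_0.
          + now rewrite scal_of_R_1. }
      intros y r s hr hs; apply Rle_antisym; eauto. }
    set (G := fun y => proj1_sig (constructive_indefinite_description _ (htotal y))).
    assert (hG : forall y, M (y, G y)).
    { intros y; exact (proj2_sig (constructive_indefinite_description _ (htotal y))). }
    exists G; repeat split.
    + intros y z; apply (huniq (plus y z)); [apply hG | apply hM; apply hG].
    + intros t y; apply (huniq (scal (of_R F t) y)); [apply hG | apply hM; apply hG].
    + intros y; apply (graph_le _ _ _ _ hM), hG.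
    + apply (huniq y0); [apply hG | apply hM].
Qed.

(** Rotating the argument turns a bound on the real part into a bound on the absolute
    value. *)
Lemma dual_of_linear (F : scalars) (Y : NormedModule (field F)) (g : Y -> field F) :
  (forall y z, g (plus y z) = plus (g y) (g z)) ->
  (forall a y, g (scal a y) = mult a (g y)) ->
  (forall y, re (g y) <= norm y) ->
  exists h : dual Y, norm h <= 1 /\ forall y, h y = g y.
Proof.
  intros hp hs hre.
  assert (hb : forall y, abs (g y) <= 1 * norm y).
  { intros y; destruct (abs_rotation F (g y)) as [u [hu <-]].
    rewrite <- hs; apply Rle_trans with (1 := hre _).
    apply Rle_trans with (1 := norm_scal u y).
    generalize (norm_ge_0 y); nra. }
  assert (hlin : @is_linear _ Y (AbsRing_NormedModule (field F)) g).
  { apply bop_of_bound with 1; [exact hp | exact hs | exact hb]. }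
  exists (Bop hlin); split; [| reflexivity].
  apply op_norm_le; intros y hy; apply Rle_trans with (1 := hb y); lra.
Qed.

(** A complex functional is recovered from its real part [G] as
    [G y - i G (i y)]. *)
Lemma norming_functional (F : scalars) (Y : NormedModule (field F)) (y0 : Y) :
  exists g : dual Y, norm g <= 1 /\ norm y0 <= abs (g y0).
Proof.
  destruct (norming_real_functional F Y y0) as [G [hp [hs [hle h0]]]].
  destruct F.
  - destruct (dual_of_linear RealScalars Y G) as [g [hg hgG]]; auto.
    exists g; split; [exact hg |]; rewrite hgG, <- h0; apply Rle_abs.
  - set (i := Ci : field ComplexScalars).
    assert (hsplit : forall (a b : R) (y : Y),
      G (scal ((a, b) : field ComplexScalars) y) = a * G y + b * G (scal i y)).
    { intros a b y; rewrite <- (hs a y), <- (hs b (scal i y)), <- hp, scal_assoc.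
      f_equal; rewrite <- (@scal_distr_r (field ComplexScalars) Y).
      apply (f_equal (fun c : field ComplexScalars => scal c y)).
      change ((a, b) = Cplus (RtoC a) (Cmult (RtoC b) Ci)).
      unfold Cplus, Cmult, RtoC, Ci; simpl; f_equal; ring. }
    destruct (dual_of_linear ComplexScalars Y
      (fun y => (G y, - G (scal i y)) : field ComplexScalars)) as [g [hg hgG]].
    + intros y z; rewrite (@scal_distr_l (field ComplexScalars) Y), !hp.
      apply injective_projections; simpl; ring.
    + intros [a b] y; rewrite scal_assoc.
      change (mult i (a, b)) with ((0 * a - 1 * b, 0 * b + 1 * a) : field ComplexScalars).
      rewrite !hsplit; apply injective_projections; simpl; ring.
    + intros y; apply hle.
    + exists g; split; [exact hg |]; rewrite hgG, <- h0.
      apply Rle_trans with (2 := re_le_Cmod _); apply Rle_abs.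
Qed.

(** * Separated sequences in infinite dimension *)

Lemma sum_n_le (u v : nat -> R) (N : nat) :
  (forall k, (k <= N)%nat -> u k <= v k) -> sum_n u N <= sum_n v N.
Proof. intros h; rewrite !sum_n_Reals; now apply sum_Rle. Qed.

Lemma sum_n_single (G : AbelianMonoid) (u : nat -> G) (k N : nat) :
  (forall n, n <> k -> u n = zero) -> (k <= N)%nat -> sum_n u N = u k.
Proof.
  intros hu hkN.
  assert (h0 : forall n, (n < k)%nat -> sum_n u n = zero).
  { intros n; induction n as [| n IH]; intros hn; [rewrite sum_O; apply hu; lia |].
    rewrite sum_Sn, IH, plus_zero_l; [apply hu |]; lia. }
  induction hkN as [| N hkN IH].
  - destruct k as [| k]; [apply sum_O |].
    rewrite sum_Sn, h0, plus_zero_l; [reflexivity | lia].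
  - rewrite sum_Sn, IH, (hu (S N)), plus_zero_r; [reflexivity | lia].
Qed.

Lemma sum_n_norm_le (F : scalars) (Y : NormedModule (field F)) (u : nat -> Y) (N : nat) :
  norm (sum_n u N) <= sum_n (fun k => norm (u k)) N.
Proof.
  induction N as [| N IH]; [rewrite !sum_O; apply Rle_refl |].
  rewrite !sum_Sn; apply Rle_trans with (1 := norm_triangle _ _).
  now apply Rplus_le_compat_r.
Qed.

Lemma scal_of_R_minus (F : scalars) (Y : NormedModule (field F)) (s t : R) (y : Y) :
  scal (of_R F (s - t)) y = @minus Y (scal (of_R F s) y) (scal (of_R F t) y).
Proof.
  unfold Rminus, minus; rewrite scal_of_R_plus; f_equal.
  rewrite <- (@scal_opp_l (field F) Y); f_equal.
  destruct F; [reflexivity | exact (RtoC_opp t)].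
Qed.

Lemma filterlim_scal_of_R (F : scalars) (Y : NormedModule (field F)) (s : nat -> R) (c : R)
  (b : Y) :
  is_lim_seq s c ->
  filterlim (fun m => scal (of_R F (s m)) b) eventually (locally (scal (of_R F c) b)).
Proof.
  intros hs; apply filterlim_norm_minus; intros eps heps.
  assert (hb : 0 < norm b + 1) by (generalize (norm_ge_0 b); lra).
  apply is_lim_seq_spec in hs.
  destruct (hs (mkposreal (eps / (norm b + 1)) (Rdiv_lt_0_compat _ _ heps hb))) as [N hN].
  exists N; intros n hn; specialize (hN n hn); simpl in hN.
  rewrite <- scal_of_R_minus, norm_scal_of_R.
  apply Rle_lt_trans with (Rabs (s n - c) * (norm b + 1)).
  - apply Rmult_le_compat_l; [apply Rabs_pos | lra].
  - apply (Rmult_lt_compat_r _ _ _ hb) in hN.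
    replace (eps / (norm b + 1) * (norm b + 1)) with eps in hN by (field; lra); exact hN.
Qed.

Lemma filterlim_sum_n (F : scalars) (Y : NormedModule (field F)) (u : nat -> nat -> Y)
  (l : nat -> Y) (n : nat) :
  (forall i, filterlim (fun m => u m i) eventually (locally (l i))) ->
  filterlim (fun m => sum_n (u m) n) eventually (locally (sum_n l n)).
Proof.
  intros h; induction n as [| n IH].
  - rewrite sum_O; apply filterlim_ext with (2 := h O); intros m; now rewrite sum_O.
  - rewrite sum_Sn; apply filterlim_ext with (fun m => plus (sum_n (u m) n) (u m (S n))).
    + intros m; now rewrite sum_Sn.
    + apply filterlim_comp_2 with (1 := IH) (2 := h (S n)), filterlim_plus.
Qed.

(** If finitely many balls of radius 1/2 cover the unit ball, expanding the error
    by 2 and approximating again writes each [y] of the ball as the sum of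
    [2^(-k) b (i k)] over [k].  Collecting the terms with the same centre gives
    finitely many convergent series of coefficients. *)
Lemma finite_net_finite_dimensional (F : scalars) (Y : NormedModule (field F)) (h : list Y) :
  (forall y, norm y <= 1 -> exists b, In b h /\ norm (minus y b) <= / 2) ->
  finite_dimensional Y.
Proof.
  intros hnet.
  set (n := length h); set (b := fun i => nth i h zero).
  exists n, b.
  assert (hidx : exists idx : Y -> nat, forall y, norm y <= 1 ->
            (idx y <= n)%nat /\ norm (minus y (b (idx y))) <= / 2).
  { exists (fun y => epsilon (inhabits O)
      (fun i => (i <= n)%nat /\ norm (minus y (b i)) <= / 2)).
    intros y hy; apply epsilon_spec.
    destruct (hnet y hy) as [c [hc hyc]].
    destruct (In_nth h c zero hc) as [i [hi <-]]; exists i; split; [unfold n; lia | exact hyc]. }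
  destruct hidx as [idx hidx].
  assert (hball : forall y, norm y <= 1 ->
            exists a : nat -> field F, y = sum_n (fun i => scal (a i) (b i)) n).
  { intros y hy.
    set (r := fix r k := match k with
      | O => y
      | S k => scal (of_R F 2) (minus (r k) (b (idx (r k))))
      end).
    assert (hr : forall k, norm (r k) <= 1).
    { intros k; induction k as [| k IH]; [exact hy |].
      simpl; rewrite norm_scal_of_R, Rabs_pos_eq by lra.
      generalize (proj2 (hidx _ IH)); lra. }
    set (d := fun k i => if Nat.eqb (idx (r k)) i then (/ 2) ^ k else 0).
    assert (hd : forall i, ex_series (fun k => d k i)).
    { intros i; apply (@ex_series_le R_AbsRing R_CompleteNormedModule _ (fun k => (/ 2) ^ k)).
      - intros k; change (Rabs (d k i) <= (/ 2) ^ k); unfold d.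
        assert (0 <= (/ 2) ^ k) by (apply pow_le; lra).
        destruct (Nat.eqb _ _); [rewrite Rabs_pos_eq | rewrite Rabs_R0]; lra.
      - apply ex_series_geom; rewrite Rabs_pos_eq; lra. }
    set (P := fun m => sum_n (fun i => scal (of_R F (sum_n (fun k => d k i) m)) (b i)) n).
    assert (hpick : forall k, sum_n (fun i => scal (of_R F (d k i)) (b i)) n =
              scal (of_R F ((/ 2) ^ k)) (b (idx (r k)))).
    { intros k; rewrite (sum_n_single _ _ (idx (r k))).
      - unfold d; now rewrite Nat.eqb_refl.
      - intros i hi; unfold d; replace (Nat.eqb (idx (r k)) i) with false.
        + apply scal_of_R_0.
        + symmetry; apply Nat.eqb_neq; congruence.
      - apply hidx, hr. }
    assert (hstep : forall k, scal (of_R F ((/ 2) ^ S k)) (r (S k)) =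
              minus (scal (of_R F ((/ 2) ^ k)) (r k)) (scal (of_R F ((/ 2) ^ k)) (b (idx (r k))))).
    { intros k; change (r (S k)) with (scal (of_R F 2) (minus (r k) (b (idx (r k))))).
      rewrite scal_of_R_mult; replace ((/ 2) ^ S k * 2) with ((/ 2) ^ k) by (simpl; field).
      unfold minus; rewrite (@scal_distr_l (field F) Y); f_equal.
      apply (@scal_opp_r (field F) Y). }
    assert (hP : forall m, minus y (P m) = scal (of_R F ((/ 2) ^ S m)) (r (S m))).
    { intros m; induction m as [| m IH].
      - rewrite hstep; unfold P.
        replace (scal (of_R F ((/ 2) ^ 0)) (r 0%nat)) with y by (symmetry; apply scal_of_R_1).
        f_equal; rewrite <- hpick; apply sum_n_ext; intros i; now rewrite sum_O.
      - rewrite hstep, <- IH, <- hpick.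
        replace (P (S m)) with
          (plus (P m) (sum_n (fun i => scal (of_R F (d (S m) i)) (b i)) n)).
        + unfold minus; rewrite (@opp_plus Y); apply plus_assoc.
        + unfold P; rewrite <- sum_n_plus; apply sum_n_ext; intros i.
          rewrite sum_Sn; symmetry; apply scal_of_R_plus. }
    exists (fun i => of_R F (Series (fun k => d k i))).
    apply (@filterlim_locally_unique nat (field F) Y eventually _ P).
    - apply filterlim_norm_minus; intros eps heps.
      assert (hg : is_lim_seq (fun m => (/ 2) ^ m) 0).
      { apply is_lim_seq_geom; rewrite Rabs_pos_eq; lra. }
      apply is_lim_seq_spec in hg; destruct (hg (mkposreal _ heps)) as [N hN].
      exists N; intros m hm.
      rewrite norm_minus_sym, hP, norm_scal_of_R.
      specialize (hN (S m) ltac:(lia)); simpl pos in hN; rewrite Rminus_0_r in hN.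
      generalize (hr (S m)) (norm_ge_0 (r (S m))) (Rabs_pos ((/ 2) ^ S m)); nra.
    - apply filterlim_sum_n; intros i; apply filterlim_scal_of_R.
      exact (Series_correct _ (hd i)). }
  intros y; destruct (Rle_dec (norm y) 1) as [hy | hy]; [now apply hball |].
  destruct (hball (scal (of_R F (/ norm y)) y)) as [a ha].
  { rewrite norm_scal_of_R, Rabs_pos_eq by (apply Rlt_le, Rinv_0_lt_compat; lra).
    rewrite Rinv_l; lra. }
  exists (fun i => mult (of_R F (norm y)) (a i)).
  rewrite (sum_n_ext _ (fun i => scal (of_R F (norm y)) (scal (a i) (b i))))
    by (intros i; symmetry; apply (@scal_assoc (field F) Y)).
  transitivity (scal (of_R F (norm y)) (sum_n (fun i => scal (a i) (b i)) n)).
  - rewrite <- ha, scal_of_R_mult, Rinv_r, scal_of_R_1; [reflexivity | lra].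
  - symmetry; apply (@sum_n_scal_l (field F) Y).
Qed.

Lemma separated_sequence (F : scalars) (Y : NormedModule (field F)) :
  ~ finite_dimensional Y -> exists z : nat -> Y, (forall n, norm (z n) <= 1) /\
  forall m n, (m < n)%nat -> / 2 <= norm (minus (z n) (z m)).
Proof.
  intros hdim.
  destruct (history_choice (fun h z => norm z <= 1 /\
     forall b : Y, In b h -> / 2 <= norm (minus z b))) as [z hz].
  - intros h; apply NNPP; intros hno; apply hdim.
    apply (finite_net_finite_dimensional F Y h); intros y hy.
    apply NNPP; intros hb; apply hno; exists y; split; [exact hy |].
    intros b hin; apply Rnot_lt_le; intros hlt; apply hb; exists b; split; [auto | lra].
  - exists z; split; [intros n; apply hz |].
    intros m n hmn; apply hz, play_in, hmn.
Qed.

(** * Operators on the space of summable sequences *)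

Lemma is_series_single (F : scalars) (Y : NormedModule (field F)) (u : nat -> Y) (k : nat) :
  (forall n, n <> k -> u n = zero) -> is_series u (u k).
Proof.
  intros hu; apply filterlim_norm_minus; intros eps heps; exists k; intros n hn.
  rewrite (sum_n_single Y u k n hu hn).
  replace (@minus Y (u k) (u k)) with (@zero Y) by (symmetry; exact (@minus_eq_zero Y (u k))).
  rewrite norm_zero; exact heps.
Qed.

Lemma l1_basis_summable (F : scalars) (k : nat) :
  ex_series (fun n => abs (if Nat.eqb n k then one else zero : field F)).
Proof.
  eexists; apply (is_series_single RealScalars R_NormedModule _ k); intros n hn.
  rewrite (proj2 (Nat.eqb_neq n k) hn); exact (@abs_zero (field F)).
Qed.

Definition l1_basis (F : scalars) (k : nat) : l1 F := L1 (l1_basis_summable F k).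

Lemma l1_norm_basis (F : scalars) (k : nat) : norm (l1_basis F k) = 1.
Proof.
  change (Series (fun n => abs (if Nat.eqb n k then one else zero : field F)) = 1).
  rewrite (is_series_unique _ (abs (if Nat.eqb k k then one else zero : field F))).
  - rewrite Nat.eqb_refl; destruct F; [exact Rabs_R1 | exact Cmod_1].
  - apply (is_series_single RealScalars R_NormedModule
      (fun n => abs (if Nat.eqb n k then one else zero : field F)) k); intros n hn.
    rewrite (proj2 (Nat.eqb_neq n k) hn); exact (@abs_zero (field F)).
Qed.

(** The coordinates of an element of the normed module [l1 F], to whose carrier the
    coercion from the record [l1_type F] does not apply as it stands. *)
Definition l1_coord (F : scalars) (a : l1 F) : nat -> field F := l1_seq a.

Lemma l1_norm_series (F : scalars) (a : l1 F) : is_series (fun k => abs (l1_coord F a k)) (norm a).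
Proof. exact (Series_correct _ (l1_summable a)). Qed.

Lemma l1_partial_sum_le (F : scalars) (a : l1 F) (N : nat) :
  sum_n (fun k => abs (l1_coord F a k)) N <= norm a.
Proof.
  apply (is_lim_seq_incr_compare (sum_n (fun k => abs (l1_coord F a k)))).
  - exact (l1_norm_series F a).
  - intros m; rewrite sum_Sn.
    generalize (abs_ge_0 (l1_coord F a (S m))); unfold plus; simpl; lra.
Qed.

Lemma l1_coord_sum_n (F : scalars) (u : nat -> l1 F) (N j : nat) :
  l1_coord F (sum_n u N) j = sum_n (fun k => l1_coord F (u k) j) N.
Proof.
  induction N as [| N IH]; [now rewrite !sum_O |].
  rewrite !sum_Sn, <- IH; reflexivity.
Qed.

Lemma sum_n_zero (G : AbelianMonoid) (u : nat -> G) (N : nat) :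
  (forall k, (k <= N)%nat -> u k = zero) -> sum_n u N = zero.
Proof.
  intros h; induction N as [| N IH]; [rewrite sum_O; auto |].
  rewrite sum_Sn, IH, plus_zero_l; auto.
Qed.

(** The remainder after [n] terms has norm equal to the tail of the series of absolute
    values. *)
Lemma l1_basis_expansion (F : scalars) (a : l1 F) :
  is_series (fun k => scal (l1_coord F a k) (l1_basis F k)) a.
Proof.
  apply filterlim_norm_minus; intros eps heps.
  assert (hlim : is_lim_seq (sum_n (fun k => abs (l1_coord F a k))) (norm a)).
  { exact (l1_norm_series F a). }
  apply is_lim_seq_spec in hlim.
  destruct (hlim (mkposreal _ heps)) as [N hN]; exists N; intros n hn.
  rewrite norm_minus_sym; specialize (hN n hn); simpl in hN.
  set (p := sum_n (fun k => scal (l1_coord F a k) (l1_basis F k)) n).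
  assert (hp : forall j, l1_coord F p j = if Nat.leb j n then l1_coord F a j else zero).
  { intros j; unfold p; rewrite l1_coord_sum_n.
    assert (hc : forall k, l1_coord F (scal (l1_coord F a k) (l1_basis F k)) j =
              mult (l1_coord F a k) (if Nat.eqb j k then one else zero)).
    { intros k; reflexivity. }
    rewrite (sum_n_ext _ _ _ hc).
    destruct (Nat.leb_spec j n) as [hj | hj].
    - rewrite (sum_n_single _ _ j n); [| | exact hj].
      + rewrite Nat.eqb_refl; apply (@mult_one_r (field F)).
      + intros k hk; rewrite (proj2 (Nat.eqb_neq j k)) by congruence.
        apply (@mult_zero_r (field F)).
    - apply sum_n_zero; intros k hk.
      rewrite (proj2 (Nat.eqb_neq j k)) by lia; apply (@mult_zero_r (field F)). }
  set (q := @minus (l1 F) a p).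
  assert (hq : forall j, abs (l1_coord F q j) =
            if Nat.leb j n then 0 else abs (l1_coord F a j)).
  { intros j; change (l1_coord F q j) with (minus (l1_coord F a j) (l1_coord F p j)).
    rewrite hp; destruct (Nat.leb j n).
    - rewrite (@minus_eq_zero (field F)); apply (@abs_zero (field F)).
    - f_equal; exact (@minus_zero_r (field F) (l1_coord F a j)). }
  assert (hqa : norm q = norm a - sum_n (fun k => abs (l1_coord F a k)) n).
  { rewrite <- (is_series_unique _ _ (l1_norm_series F q)).
    rewrite <- (is_series_unique _ _ (l1_norm_series F a)) at 1.
    rewrite (Series_incr_n _ (S n) (Nat.lt_0_succ n) (ex_intro _ _ (l1_norm_series F q))).
    rewrite (Series_incr_n _ (S n) (Nat.lt_0_succ n) (ex_intro _ _ (l1_norm_series F a))).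
    rewrite <- !sum_n_Reals; simpl Nat.pred.
    rewrite (sum_n_zero R_AbelianMonoid (fun k => abs (l1_coord F q k)) n).
    - rewrite (Series_ext (fun k => abs (l1_coord F q (S n + k)))
                          (fun k => abs (l1_coord F a (S n + k)))).
      + change (@zero R_AbelianMonoid) with 0; ring.
      + intros k; rewrite hq; now rewrite (proj2 (Nat.leb_gt _ _)) by lia.
    - intros k hk; rewrite hq; now rewrite (proj2 (Nat.leb_le _ _) hk). }
  change (norm q < eps); rewrite hqa; apply Rabs_def2 in hN; lra.
Qed.

Lemma l1_operator_expansion (F : scalars) (Y : NormedModule (field F)) (T : bop (l1 F) Y)
  (a : l1 F) :
  is_series (fun k => scal (l1_coord F a k) (T (l1_basis F k))) (T a).
Proof.
  assert (hcont := linear_cont T a (bop_linear T)).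
  assert (h := filterlim_comp _ _ _ _ _ _ _ _ (l1_basis_expansion F a) hcont).
  apply filterlim_ext with (2 := h); intros N.
  rewrite bop_sum_n; apply sum_n_ext; intros k; apply (linear_scal _ (bop_linear T)).
Qed.

Lemma series_norm_le (F : scalars) (Y : NormedModule (field F)) (u : nat -> Y) (l : Y) (M : R) :
  is_series u l -> (forall N, norm (sum_n u N) <= M) -> norm l <= M.
Proof.
  intros hu hM.
  apply (is_lim_seq_le (fun N => norm (sum_n u N)) (fun _ => M) (norm l) M hM).
  - exact (filterlim_comp _ _ _ _ _ _ _ _ hu (filterlim_norm l)).
  - apply is_lim_seq_const.
Qed.

Lemma sum_n_scal_norm_le (F : scalars) (Y : NormedModule (field F)) (v : nat -> Y) (m : R)
  (a : l1 F) (N : nat) :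
  0 <= m -> (forall k, norm (v k) <= m) ->
  norm (sum_n (fun k => scal (l1_coord F a k) (v k)) N) <= m * norm a.
Proof.
  intros hm hv.
  apply Rle_trans with (1 := sum_n_norm_le _ _ _ _).
  apply Rle_trans with (m * sum_n (fun k => abs (l1_coord F a k)) N).
  - rewrite <- (@sum_n_mult_l R_Ring); apply sum_n_le; intros k _.
    apply Rle_trans with (1 := norm_scal _ _).
    rewrite Rmult_comm; apply Rmult_le_compat_r; [apply abs_ge_0 | apply hv].
  - apply Rmult_le_compat_l; [exact hm | apply l1_partial_sum_le].
Qed.

Lemma l1_operator_le (F : scalars) (Y : NormedModule (field F)) (T : bop (l1 F) Y) (m : R)
  (a : l1 F) :
  0 <= m -> (forall k, norm (T (l1_basis F k)) <= m) -> norm (T a) <= m * norm a.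
Proof.
  intros hm hT.
  apply series_norm_le with (1 := l1_operator_expansion F Y T a); intros N.
  now apply (sum_n_scal_norm_le F Y (fun k => T (l1_basis F k))).
Qed.

Lemma l1_operator_ge (F : scalars) (Y : NormedModule (field F)) (T : bop (l1 F) Y) (c : R)
  (a : l1 F) :
  (forall N, c * sum_n (fun k => abs (l1_coord F a k)) N <=
     norm (sum_n (fun k => scal (l1_coord F a k) (T (l1_basis F k))) N)) ->
  c * norm a <= norm (T a).
Proof.
  intros h.
  assert (h1 : is_lim_seq (fun N => c * sum_n (fun k => abs (l1_coord F a k)) N) (c * norm a)).
  { apply (is_lim_seq_scal_l _ c (norm a)); exact (l1_norm_series F a). }
  assert (h2 : is_lim_seq
    (fun N => norm (sum_n (fun k => scal (l1_coord F a k) (T (l1_basis F k))) N)) (norm (T a))).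
  { exact (filterlim_comp _ _ _ _ _ _ _ _ (l1_operator_expansion F Y T a)
      (filterlim_norm (T a))). }
  exact (is_lim_seq_le _ _ _ _ h h1 h2).
Qed.

Lemma l1_operator_exists (F : scalars) (Y : CompleteNormedModule (field F)) (v : nat -> Y)
  (M : R) :
  (forall k, norm (v k) <= M) ->
  exists T : bop (l1 F) Y, forall k, T (l1_basis F k) = v k.
Proof.
  intros hv.
  assert (hM : 0 <= M) by (apply Rle_trans with (2 := hv O), norm_ge_0).
  assert (hex : forall a : l1 F, exists l : Y, is_series (fun k => scal (l1_coord F a k) (v k)) l).
  { intros a; apply (@ex_series_le (field F) Y _ (fun k => M * abs (l1_coord F a k))).
    - intros k; apply Rle_trans with (1 := @norm_scal (field F) Y _ _).
      rewrite Rmult_comm; apply Rmult_le_compat_r; [apply abs_ge_0 | apply hv].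
    - exact (@ex_series_scal R_AbsRing R_NormedModule M _ (ex_intro _ _ (l1_norm_series F a))). }
  set (f := fun a => proj1_sig (constructive_indefinite_description _ (hex a))).
  assert (hf : forall a, is_series (fun k => scal (l1_coord F a k) (v k)) (f a)).
  { intros a; exact (proj2_sig (constructive_indefinite_description _ (hex a))). }
  assert (huniq : forall u (l l' : Y), is_series u l -> is_series u l' -> l = l').
  { intros u l l'; apply (@filterlim_locally_unique nat (field F) Y eventually _). }
  assert (hlin : is_linear f).
  { apply bop_of_bound with M.
    - intros a b; apply (huniq _ _ _ (hf _)).
      apply is_series_ext with (2 := is_series_plus _ _ _ _ (hf a) (hf b)).
      intros k; symmetry; exact (@scal_distr_r (field F) Y (l1_coord F a k) (l1_coord F b k) (v k)).
    - intros c a; apply (huniq _ _ _ (hf _)).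
      apply is_series_ext with (2 := is_series_scal c _ _ (hf a)).
      intros k; exact (@scal_assoc (field F) Y c (l1_coord F a k) (v k)).
    - intros a; apply series_norm_le with (1 := hf a); intros N.
      now apply sum_n_scal_norm_le. }
  exists (Bop hlin); intros k.
  apply (huniq _ _ _ (hf (l1_basis F k))).
  assert (hk : scal (l1_coord F (l1_basis F k) k) (v k) = v k).
  { simpl; rewrite Nat.eqb_refl; apply (@scal_one (field F) Y). }
  rewrite <- hk.
  apply (is_series_single F Y (fun n => scal (l1_coord F (l1_basis F k) n) (v n)) k).
  intros n hn; simpl; rewrite (proj2 (Nat.eqb_neq n k) hn).
  apply (@scal_zero_l (field F) Y).
Qed.

(** Bolzano-Weierstrass for the scalar coefficient. *)
Lemma rank_one_compact (F : scalars) (X Y : NormedModule (field F)) (K : bop X Y)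
  (g : X -> field F) (M : R) (y : Y) :
  (forall x, norm x <= 1 -> abs (g x) <= M) -> (forall x, K x = scal (g x) y) ->
  compact_op K.
Proof.
  intros hg hK x hx.
  destruct (bounded_scalar_subsequence F (fun n => g (x n)) M) as [phi [l [hphi hl]]].
  { intros n; apply hg, hx. }
  exists phi, (scal l y); split; [exact hphi |].
  apply filterlim_norm_minus; intros eps heps.
  assert (hy : 0 < norm y + 1) by (generalize (norm_ge_0 y); lra).
  destruct (hl (eps / (norm y + 1))) as [N hN]; [now apply Rdiv_lt_0_compat |].
  exists N; intros n hn; specialize (hN n hn).
  rewrite hK.
  replace (@minus Y (scal (g (x (phi n))) y) (scal l y)) with
    (scal (minus (g (x (phi n))) l) y).
  - apply Rle_lt_trans with (1 := norm_scal _ _).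
    apply Rle_lt_trans with (abs (minus (g (x (phi n))) l) * (norm y + 1)).
    + apply Rmult_le_compat_l; [apply abs_ge_0 | lra].
    + apply (Rmult_lt_compat_r _ _ _ hy) in hN.
      replace (eps / (norm y + 1) * (norm y + 1)) with eps in hN by (field; lra); exact hN.
  - unfold minus; rewrite (@scal_distr_r (field F) Y); f_equal.
    apply (@scal_opp_l (field F) Y).
Qed.

(** * Sequences with small oscillation *)

Lemma abs_minus_sym (F : scalars) (a b : field F) : abs (minus a b) = abs (minus b a).
Proof. rewrite <- (abs_opp (minus a b)); f_equal; exact (@opp_minus (field F) a b). Qed.

Lemma abs_minus_triangle (F : scalars) (a b c : field F) :
  abs (minus a c) <= abs (minus a b) + abs (minus b c).
Proof. rewrite (minus_trans b); apply abs_triangle. Qed.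

Lemma abs_minus_le (F : scalars) (a b : field F) : abs (minus a b) <= abs a + abs b.
Proof. rewrite <- (abs_opp b); apply abs_triangle. Qed.

(** Replacing [c] and [c'] by nearby values [p] and [q] changes the difference by at
    most [2 * rho]. *)
Lemma re_mult_gap (F : scalars) (u a p q c c' : field F) (rho : R) :
  abs u <= 1 -> abs (minus p c) <= rho -> abs (minus q c') <= rho ->
  re (mult u (mult a (minus c c'))) - 2 * rho * abs a <= re (mult u (mult a (minus p q))).
Proof.
  intros hu hp hq.
  set (e := minus (minus p c) (minus q c')).
  assert (E : mult u (mult a (minus p q)) =
            plus (mult u (mult a (minus c c'))) (mult u (mult a e))).
  { rewrite <- !(@mult_distr_l (field F)); do 2 f_equal; unfold e; destruct F.
    - change (p - q = (c - c') + ((p - c) - (q - c'))); ring.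
    - apply injective_projections; unfold minus, plus, opp; simpl; ring. }
  rewrite E, re_plus.
  assert (he : abs e <= 2 * rho).
  { apply Rle_trans with (1 := abs_minus_le F _ _); lra. }
  assert (hre := re_le_abs F (mult u (mult a e))).
  rewrite !abs_mult_eq in hre; apply Rabs_le_between in hre.
  generalize (abs_ge_0 u) (abs_ge_0 a) (abs_ge_0 e); intros h1 h2 h3.
  assert (abs u * (abs a * abs e) <= 1 * (abs a * (2 * rho))).
  { apply Rmult_le_compat; auto; [now apply Rmult_le_pos | now apply Rmult_le_compat_l]. }
  lra.
Qed.

(** For a finite combination of the [w k] with coefficients [a k], choose two functionals
    of the dual ball with opposite patterns: their difference takes values within
    [2 * rho] of [+d] or [-d] on the [w k], where [d = c - c'].  Matching the pattern
    to the signs of re (u a_k d) bounds the sum of their absolute values by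
    [2 * norm + 2 * rho * sum |a_k|].  Adding this for [u = 1] and for the [u] of
    [abs_le_two_re] gives |d| sum |a_k| <= 4 norm + 4 rho sum |a_k|, and
    [5 * rho <= |d|] leaves the lower estimate with constant [rho / 4]. *)
Lemma independent_values_l1_copy (F : scalars) (Y : CompleteNormedModule (field F))
  (w : nat -> Y) (c c' : field F) (rho : R) :
  0 < rho -> 5 * rho <= abs (minus c c') -> (forall k, norm (w k) <= 1) ->
  (forall (sigma : nat -> bool) N, exists g : dual Y, norm g <= 1 /\
     forall k, (k <= N)%nat -> abs (minus (g (w k)) (if sigma k then c else c')) <= rho) ->
  contains_copy (l1 F) Y.
Proof.
  intros hrho hfar hw hind.
  destruct (l1_operator_exists F Y w 1 hw) as [U hU].
  exists U, (rho / 4); split; [lra |]; intros a.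
  apply l1_operator_ge; intros N.
  rewrite (sum_n_ext _ (fun k => scal (l1_coord F a k) (w k))) by (intros k; now rewrite hU).
  set (s := fun n => sum_n (fun k => scal (l1_coord F a k) (w k)) n : Y).
  change (rho / 4 * sum_n (fun k => abs (l1_coord F a k)) N <= norm (s N)).
  set (d := minus c c').
  assert (hhalf : forall u : field F, abs u <= 1 ->
    sum_n (fun k => Rabs (re (mult u (mult (l1_coord F a k) d)))) N <=
    2 * norm (s N) + 2 * rho * sum_n (fun k => abs (l1_coord F a k)) N).
  { intros u hu.
    set (sigma := fun k =>
      if Rle_dec 0 (re (mult u (mult (l1_coord F a k) d))) then true else false).
    destruct (hind sigma N) as [g1 [hg1 h1]].
    destruct (hind (fun k => negb (sigma k)) N) as [g2 [hg2 h2]].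
    set (psi := fun y : Y => re (mult u (minus (g1 y) (g2 y)))).
    assert (hterm : forall k, (k <= N)%nat ->
      Rabs (re (mult u (mult (l1_coord F a k) d))) - 2 * rho * abs (l1_coord F a k) <=
      psi (scal (l1_coord F a k) (w k))).
    { intros k hk; specialize (h1 k hk); specialize (h2 k hk); unfold psi.
      replace (minus (g1 (scal (l1_coord F a k) (w k))) (g2 (scal (l1_coord F a k) (w k))))
        with (mult (l1_coord F a k) (minus (g1 (w k)) (g2 (w k)))).
      2: { unfold minus; rewrite (@mult_distr_l (field F)).
           rewrite (linear_scal _ (bop_linear g1)), (linear_scal _ (bop_linear g2)).
           f_equal; symmetry; apply (@opp_mult_r (field F)). }
      unfold sigma in h1, h2.
      destruct (Rle_dec 0 (re (mult u (mult (l1_coord F a k) d)))) as [hr | hr]; simpl in h2.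
      - rewrite Rabs_pos_eq by exact hr; now apply re_mult_gap.
      - rewrite Rabs_left by lra.
        replace (- re (mult u (mult (l1_coord F a k) d))) with
          (re (mult u (mult (l1_coord F a k) (minus c' c)))).
        + now apply re_mult_gap.
        + rewrite <- re_opp; f_equal; unfold d.
          rewrite <- (@opp_minus (field F) c c').
          rewrite <- (@opp_mult_r (field F)), <- (@opp_mult_r (field F)); reflexivity. }
    assert (hsum : forall n, (n <= N)%nat ->
      sum_n (fun k => Rabs (re (mult u (mult (l1_coord F a k) d)))) n
        - 2 * rho * sum_n (fun k => abs (l1_coord F a k)) n <= psi (s n)).
    { assert (hpsi : forall x y, psi (plus x y) = psi x + psi y).
      { intros x y; unfold psi; rewrite <- re_plus, <- (@mult_distr_l (field F)).
        do 2 f_equal; unfold minus.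
        rewrite (linear_plus _ (bop_linear g1)), (linear_plus _ (bop_linear g2)).
        rewrite <- plus_swap; f_equal; apply (@opp_plus (field F)). }
      intros n; induction n as [| n IH]; intros hn; unfold s.
      - rewrite !sum_O; now apply hterm.
      - rewrite !sum_Sn, hpsi; specialize (IH ltac:(lia)).
        change (@plus R_AbelianMonoid) with Rplus.
        change (psi (s n)) with (psi (sum_n (fun k => scal (l1_coord F a k) (w k)) n)) in IH.
        generalize (hterm (S n) hn) IH; clear; intros; lra. }
    assert (hup : psi (s N) <= 2 * norm (s N)).
    { unfold psi.
      assert (hre := re_le_abs F (mult u (minus (g1 (s N)) (g2 (s N))))).
      apply Rabs_le_between in hre; rewrite abs_mult_eq in hre.
      assert (hm : abs (minus (g1 (s N)) (g2 (s N))) <= 2 * norm (s N)).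
      { apply Rle_trans with (1 := abs_minus_le F _ _).
        generalize (dual_ball_le F Y g1 (s N) hg1) (dual_ball_le F Y g2 (s N) hg2); lra. }
      generalize (abs_ge_0 (minus (g1 (s N)) (g2 (s N)))) (abs_ge_0 u); nra. }
    generalize (hsum N (le_n N)); lra. }
  destruct (abs_le_two_re F) as [j [hj hsplit]].
  assert (hone : abs (one : field F) <= 1).
  { rewrite <- of_R_one, abs_of_R, Rabs_R1; lra. }
  assert (hd : abs d * sum_n (fun k => abs (l1_coord F a k)) N <=
     sum_n (fun k => Rabs (re (mult one (mult (l1_coord F a k) d)))) N +
     sum_n (fun k => Rabs (re (mult j (mult (l1_coord F a k) d)))) N).
  { rewrite <- (@sum_n_mult_l R_Ring).
    rewrite <- (@sum_n_plus R_AbelianMonoid).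
    apply sum_n_le; intros k _.
    rewrite (@mult_one_l (field F)).
    apply Rle_trans with (2 := hsplit _).
    rewrite abs_mult_eq; apply Req_le, Rmult_comm. }
  generalize (hhalf one hone) (hhalf j hj); intros h1 h2.
  assert (hpos : 0 <= sum_n (fun k => abs (l1_coord F a k)) N).
  { rewrite sum_n_Reals; apply cond_pos_sum; intros k; apply abs_ge_0. }
  assert (5 * rho * sum_n (fun k => abs (l1_coord F a k)) N <=
          abs d * sum_n (fun k => abs (l1_coord F a k)) N).
  { apply Rmult_le_compat_r; [exact hpos | exact hfar]. }
  lra.
Qed.

Lemma infinite_sub (P : nat -> Prop) (psi : nat -> nat) :
  incr psi -> infinite (fun k => P (psi k)) -> infinite P.
Proof.
  intros hpsi h N; destruct (h N) as [n [hn hP]]; exists (psi n); split; [| exact hP].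
  generalize (incr_le_id _ hpsi n); lia.
Qed.

Lemma not_infinite_both (F : scalars) (Y : CompleteNormedModule (field F))
  (z : nat -> Y) (c c' : field F) (rho : R) :
  ~ contains_copy (l1 F) Y -> 0 < rho -> 5 * rho <= abs (minus c c') ->
  (forall k, norm (z k) <= 1) ->
  exists phi, incr phi /\ forall g : dual Y, norm g <= 1 ->
    ~ (infinite (fun k => abs (minus (g (z (phi k))) c) <= rho) /\
       infinite (fun k => abs (minus (g (z (phi k))) c') <= rho)).
Proof.
  intros hno hrho hfar hz.
  destruct (independence_dichotomy
    (fun n (g : dual Y) => norm g <= 1 /\ abs (minus (g (z n)) c) <= rho)
    (fun n (g : dual Y) => norm g <= 1 /\ abs (minus (g (z n)) c') <= rho))
    as [[phi [hphi hind]] | [phi [hphi hdep]]].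
  - destruct hno.
    apply (independent_values_l1_copy F Y (fun k => z (phi k)) c c' rho hrho hfar).
    + intros k; apply hz.
    + intros sigma N; destruct (hind sigma (S N)) as [g hg]; exists g; split.
      * specialize (hg O ltac:(lia)); destruct (sigma O); apply hg.
      * intros k hk; specialize (hg k ltac:(lia)); destruct (sigma k); apply hg.
  - exists phi; split; [exact hphi |]; intros g hg [h1 h2]; apply (hdep g); split.
    + intros N; destruct (h1 N) as [n hn]; exists n; tauto.
    + intros N; destruct (h2 N) as [n hn]; exists n; tauto.
Qed.

Lemma not_infinite_both_list (F : scalars) (Y : CompleteNormedModule (field F))
  (z : nat -> Y) (rho : R) (L : list (field F * field F)) :
  ~ contains_copy (l1 F) Y -> 0 < rho ->
  (forall p, In p L -> 5 * rho <= abs (minus (fst p) (snd p))) ->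
  (forall k, norm (z k) <= 1) ->
  exists phi, incr phi /\ forall p, In p L -> forall g : dual Y, norm g <= 1 ->
    ~ (infinite (fun k => abs (minus (g (z (phi k))) (fst p)) <= rho) /\
       infinite (fun k => abs (minus (g (z (phi k))) (snd p)) <= rho)).
Proof.
  intros hno hrho hL hz; induction L as [| p L IH].
  - exists (fun n => n); split; [intros n; lia | intros p []].
  - destruct IH as [phi [hphi H]]; [intros q hq; apply hL; now right |].
    destruct (not_infinite_both F Y (fun k => z (phi k)) (fst p) (snd p) rho hno hrho)
      as [psi [hpsi Hp]]; [apply hL; now left | intros k; apply hz |].
    exists (fun n => phi (psi n)); split; [now apply incr_comp |].
    intros q [<- | hq] g hg; [now apply Hp |].
    intros [h1 h2]; apply (H q hq g hg); split.
    + exact (infinite_sub (fun k => abs (minus (g (z (phi k))) (fst q)) <= rho) _ hpsi h1).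
    + exact (infinite_sub (fun k => abs (minus (g (z (phi k))) (snd q)) <= rho) _ hpsi h2).
Qed.

(** For each functional of the dual ball, the cells visited infinitely often are
    pairwise at distance less than [5 * rho] between centres, and all but finitely
    many values lie in these cells, hence within [rho + 5 * rho + rho] of each other. *)
Lemma small_oscillation_subsequence (F : scalars) (Y : CompleteNormedModule (field F))
  (z : nat -> Y) (rho : R) :
  ~ contains_copy (l1 F) Y -> 0 < rho -> (forall k, norm (z k) <= 1) ->
  exists phi, incr phi /\ forall g : dual Y, norm g <= 1 ->
    exists N, forall k l, (N <= k)%nat -> (N <= l)%nat ->
    abs (minus (g (z (phi k))) (g (z (phi l)))) <= 7 * rho.
Proof.
  intros hno hrho hz.
  destruct (field_grid F rho hrho) as [Cs hCs].
  set (far := fun p : field F * field F =>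
    if Rle_dec (5 * rho) (abs (minus (fst p) (snd p))) then true else false).
  destruct (not_infinite_both_list F Y z rho (filter far (list_prod Cs Cs)))
    as [phi [hphi H]]; auto.
  { intros p hp; apply filter_In in hp; destruct hp as [_ hp]; unfold far in hp.
    destruct (Rle_dec _ _); [assumption | discriminate]. }
  exists phi; split; [exact hphi |]; intros g hg.
  set (near := fun c k => abs (minus (g (z (phi k))) c) <= rho).
  assert (hfin : exists N, forall c, In c Cs -> ~ infinite (near c) ->
            forall k, (N <= k)%nat -> ~ near c k).
  { clear hCs far H; induction Cs as [| c Cs [N IH]]; [exists O; intros c [] |].
    destruct (classic (infinite (near c))) as [hc | hc].
    - exists N; intros c' [<- | hin] hc' k hk; [contradiction | now apply IH].
    - assert (hc' := hc); apply not_all_ex_not in hc'; destruct hc' as [N' hN'].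
      exists (N + N')%nat; intros c' [<- | hin] hnot k hk hnear.
      + apply hN'; exists k; split; [lia | exact hnear].
      + apply (IH c' hin hnot k); [lia | exact hnear]. }
  destruct hfin as [N hN].
  assert (hval : forall k, (N <= k)%nat -> exists c, In c Cs /\ near c k /\ infinite (near c)).
  { intros k hk; destruct (hCs (g (z (phi k)))) as [c [hc hnear]].
    - apply Rle_trans with (1 := dual_ball_le F Y g _ hg), hz.
    - exists c; repeat split; auto; apply NNPP; intros hinf.
      exact (hN c hc hinf k hk hnear). }
  exists N; intros k l hk hl.
  destruct (hval k hk) as [c [hc [hck hic]]], (hval l hl) as [c' [hc' [hcl hic']]].
  assert (hcc : abs (minus c c') < 5 * rho).
  { apply Rnot_le_lt; intros hle.
    apply (H (c, c')) with (g := g); [| exact hg | split; assumption].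
    apply filter_In; split; [now apply in_prod |]; unfold far; simpl.
    destruct (Rle_dec _ _); [reflexivity | contradiction]. }
  unfold near in hck, hcl; rewrite abs_minus_sym in hcl.
  apply Rle_trans with (1 := abs_minus_triangle F _ c _).
  assert (hcl' := abs_minus_triangle F c c' (g (z (phi l)))).
  apply Rle_trans with (rho + (5 * rho + rho)); [| lra].
  apply Rplus_le_compat; [exact hck |].
  apply Rle_trans with (1 := hcl'), Rplus_le_compat; [lra | exact hcl].
Qed.

Lemma nearly_weakly_null_sequence (F : scalars) (Y : CompleteNormedModule (field F))
  (eps : R) :
  ~ finite_dimensional Y -> ~ contains_copy (l1 F) Y -> 0 < eps ->
  exists w : nat -> Y, (forall n, / 2 <= norm (w n)) /\
    forall g : dual Y, norm g <= 1 -> exists N, forall n, (N <= n)%nat -> abs (g (w n)) <= eps.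
Proof.
  intros hdim hno heps.
  destruct (separated_sequence F Y hdim) as [z [hz hsep]].
  destruct (small_oscillation_subsequence F Y z (eps / 7) hno)
    as [phi [hphi hosc]]; [lra | exact hz |].
  exists (fun n => @minus Y (z (phi (S n))) (z (phi n))); split.
  - intros n; apply hsep, hphi.
  - intros g hg; destruct (hosc g hg) as [N hN]; exists N; intros n hn.
    rewrite bop_minus.
    apply Rle_trans with (1 := hN (S n) n ltac:(lia) hn); lra.
Qed.

(** * Slices and operators whose adjoint misses its norm *)

(** Shrink and rotate a point where [f] almost attains its norm; positivity of the real
    part makes [f x] nonzero, whatever [delta] is. *)
Lemma slice_interior_point (F : scalars) (Y : NormedModule (field F)) (f : dual Y) (delta : R) :
  norm f = 1 -> 0 < delta -> exists x : Y, norm x < 1 /\ 0 < re (f x) /\ 1 - delta < re (f x).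
Proof.
  intros hf hdelta.
  set (d := Rmin delta 1).
  assert (hd : 0 < d <= 1 /\ d <= delta).
  { unfold d; split; [split; [apply Rmin_glb_lt; lra | apply Rmin_r] | apply Rmin_l]. }
  assert (hy : exists y : Y, norm y <= 1 /\ 1 - d / 2 < abs (f y)).
  { apply NNPP; intros hno.
    assert (op_norm f <= 1 - d / 2).
    { apply op_norm_le; intros y hy; apply Rnot_lt_le; intros hlt.
      apply hno; exists y; split; [exact hy | exact hlt]. }
    change (op_norm f = 1) in hf; lra. }
  destruct hy as [y [hy hfy]].
  destruct (abs_rotation F (f y)) as [u [hu huy]].
  exists (scal (of_R F (1 - d / 4)) (scal u y)).
  rewrite norm_scal_of_R, Rabs_pos_eq by lra.
  assert (hre : re (f (scal (of_R F (1 - d / 4)) (scal u y))) = (1 - d / 4) * abs (f y)).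
  { rewrite !(linear_scal _ (bop_linear f)).
    transitivity (re (mult (of_R F (1 - d / 4)) (mult u (f y)))); [reflexivity |].
    now rewrite re_of_R_mult, huy. }
  rewrite hre.
  assert (hn : norm (scal u y) <= 1).
  { apply Rle_trans with (1 := norm_scal u y).
    generalize (norm_ge_0 y) (abs_ge_0 u); nra. }
  assert (h0 := norm_ge_0 (scal u y)).
  repeat split; nra.
Qed.

Lemma norm_symmetric_gap (F : scalars) (Y : NormedModule (field F)) (x v : Y) :
  norm (@minus Y (@plus Y x v) (@minus Y x v)) = 2 * norm v.
Proof.
  rewrite <- (Rabs_pos_eq 2), <- (norm_scal_of_R F Y 2 v) by lra; f_equal.
  replace 2 with (1 + 1) by ring; rewrite scal_of_R_plus, scal_of_R_1.
  transitivity (plus (plus x v) (plus (opp x) v)).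
  - unfold minus at 1; f_equal; rewrite (@opp_minus Y x v).
    unfold minus; apply plus_comm.
  - rewrite plus_swap; transitivity (plus zero (plus v v)).
    + f_equal; exact (@plus_opp_r Y x).
    + apply plus_zero_l.
Qed.

(** Intermediate value theorem for the larger of the two norms: at [t = 0] it is
    [norm x], and at [t = 4] the two points are at distance [8 * norm w >= 4], so one of
    them has norm at least 2.  A negative [t] serves when the larger norm is that of
    the difference. *)
Lemma symmetric_level (F : scalars) (Y : NormedModule (field F)) (x w : Y) (c : R) :
  norm x < c < 1 -> / 2 <= norm w -> exists t, Rabs t <= 4 /\
  norm (@plus Y x (scal (of_R F t) w)) = c /\ norm (@minus Y x (scal (of_R F t) w)) <= c.
Proof.
  intros [hxc hc] hw.
  set (n := fun t => norm (@plus Y x (scal (of_R F t) w))).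
  assert (hlip : forall s t, n s <= n t + Rabs (s - t) * norm w).
  { intros s t; unfold n.
    assert (E : scal (of_R F s) w = @plus Y (scal (of_R F t) w) (scal (of_R F (s - t)) w)).
    { rewrite <- scal_of_R_plus; do 2 f_equal; ring. }
    rewrite E, (@plus_assoc Y).
    apply Rle_trans with (1 := norm_triangle _ _); rewrite norm_scal_of_R; lra. }
  assert (hopp : forall t, n (- t) = norm (@minus Y x (scal (of_R F t) w))).
  { intros t; unfold n, minus; do 2 f_equal.
    replace (- t) with (0 - t) by ring.
    rewrite scal_of_R_minus, scal_of_R_0; unfold minus; apply plus_zero_l. }
  assert (hcont : forall a, continuity_pt (fun t => Rmax (n t) (n (- t)) - c) a).
  { assert (hn : forall a, continuity_pt n a).
    { intros a eps heps.
      assert (hw1 : 0 < norm w + 1) by lra.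
      exists (eps / (norm w + 1)); split; [now apply Rdiv_lt_0_compat |].
      intros t [_ ht]; unfold dist in *; simpl in *; unfold R_dist in *.
      apply (Rmult_lt_compat_r _ _ _ hw1) in ht.
      replace (eps / (norm w + 1) * (norm w + 1)) with eps in ht by (field; lra).
      generalize (hlip t a) (hlip a t) (Rabs_pos (t - a)).
      rewrite (Rabs_minus_sym a t); intros h1 h2 h3.
      apply Rabs_def1; lra. }
    assert (hn' : forall a, continuity_pt (fun t => n (- t)) a).
    { intros a; apply (continuity_pt_comp Ropp n); [| apply hn].
      apply derivable_continuous_pt, derivable_pt_opp, derivable_pt_id. }
    intros a; apply continuity_pt_minus; [| apply continuity_pt_const; intros ? ?; reflexivity].
    (* max (a, b) = (a + b + |a - b|) / 2 *)
    apply (continuity_pt_ext (fun t => / 2 * (n t + n (- t) + Rabs (n t - n (- t))))).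
    - intros t; unfold Rmax, Rabs; destruct (Rle_dec _ _), (Rcase_abs _); lra.
    - apply continuity_pt_scal, continuity_pt_plus.
      + now apply continuity_pt_plus.
      + apply (continuity_pt_comp (fun t => n t - n (- t)) Rabs); [now apply continuity_pt_minus |].
        apply Rcontinuity_abs. }
  assert (hn0 : n 0 = norm x).
  { unfold n; now rewrite scal_of_R_0, plus_zero_r. }
  destruct (Ranalysis5.IVT_interv (fun t => Rmax (n t) (n (- t)) - c) 0 4) as [t [ht hroot]].
  - intros a _; apply hcont.
  - lra.
  - rewrite Ropp_0, hn0, Rmax_left by lra; lra.
  - assert (h4 : 4 <= n 4 + n (- (4))).
    { rewrite hopp; unfold n.
      apply Rle_trans with (norm (@minus Y (@plus Y x (scal (of_R F 4) w))
                                           (@minus Y x (scal (of_R F 4) w)))).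
      - rewrite norm_symmetric_gap, norm_scal_of_R, Rabs_pos_eq; lra.
      - apply norm_minus_le. }
    generalize (Rmax_l (n 4) (n (- (4)))) (Rmax_r (n 4) (n (- (4)))); lra.
  - assert (hmax : Rmax (n t) (n (- t)) = c) by lra.
    generalize (Rmax_l (n t) (n (- t))) (Rmax_r (n t) (n (- t))); rewrite hmax; intros h1 h2.
    destruct (Rmax_case_strong (n t) (n (- t)) (fun m => m = n t \/ m = n (- t))) as [E | E]; auto.
    + exists t; rewrite Rabs_pos_eq by lra; split; [lra |].
      split; [unfold n in *; congruence |]; now rewrite <- hopp.
    + exists (- t); rewrite Rabs_Ropp, Rabs_pos_eq by lra; split; [lra |].
      split; [unfold n in *; congruence |].
      rewrite <- hopp, Ropp_involutive; exact h1.
Qed.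

Lemma field_inverse (F : scalars) (a : field F) : re a <> 0 -> exists u, mult u a = one.
Proof.
  destruct F; intros ha.
  - exists (/ a); exact (Rinv_l a ha).
  - exists (/ (a : C))%C; apply (Cinv_l a); intros E; apply ha; rewrite E; reflexivity.
Qed.

(** The sum functional on the summable sequences is obtained as [f] composed with the
    operator sending each basis vector to [x / f x]. *)
Lemma l1_constant_operator (F : scalars) (Y : CompleteNormedModule (field F)) (f : dual Y)
  (x : Y) :
  re (f x) <> 0 -> exists K : bop (l1 F) Y, compact_op K /\ forall k, K (l1_basis F k) = x.
Proof.
  intros hx; destruct (field_inverse F (f x) hx) as [u hu].
  destruct (l1_operator_exists F Y (fun _ => scal u x) (norm (scal u x))) as [S hS].
  { intros _; apply Rle_refl. }
  assert (hb : forall a, abs (f (S a)) <= norm f * norm S * norm a).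
  { intros a; apply Rle_trans with (1 := op_norm_bound f (S a)).
    rewrite Rmult_assoc; apply Rmult_le_compat_l; [apply op_norm_ge_0 |].
    apply op_norm_bound. }
  assert (hlin : is_linear (fun a => scal (f (S a)) x)).
  { apply bop_of_bound with (norm f * norm S * norm x).
    - intros a b; rewrite (linear_plus _ (bop_linear S)), (linear_plus _ (bop_linear f)).
      apply (@scal_distr_r (field F) Y).
    - intros c a; rewrite (linear_scal _ (bop_linear S)), (linear_scal _ (bop_linear f)).
      symmetry; apply (@scal_assoc (field F) Y).
    - intros a; apply Rle_trans with (1 := @norm_scal (field F) Y (f (S a)) x).
      replace (norm f * norm S * norm x * norm a) with
        (norm f * norm S * norm a * norm x) by ring.
      apply Rmult_le_compat_r; [apply norm_ge_0 | apply hb]. }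
  exists (Bop hlin); split.
  - apply (rank_one_compact F _ _ (Bop hlin) (fun a => f (S a)) (norm f * norm S) x).
    + intros a ha; apply Rle_trans with (1 := hb a).
      assert (0 <= norm f * norm S) by (apply Rmult_le_pos; apply op_norm_ge_0).
      nra.
    + reflexivity.
  - intros k; simpl; rewrite hS, (linear_scal _ (bop_linear f)).
    transitivity (scal one x); [| apply (@scal_one (field F) Y)].
    f_equal; exact hu.
Qed.

(** The operator T sending the basis vectors to [x + z n] is a perturbation of a
    rank-one operator by one of norm at most [q].  Its adjoint has norm at least 1 by
    Hahn-Banach, yet the image of each functional in the dual ball has norm below 1:
    finitely many coordinates are bounded by the norms of the [x + z n], the others
    by [s]. *)
Lemma not_ACPP_of_perturbations (F : scalars) (Y : CompleteNormedModule (field F))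
  (f : dual Y) (x : Y) (z : nat -> Y) (q s : R) :
  re (f x) <> 0 -> norm x <= 1 -> q < 1 -> s < 1 ->
  (forall n, norm (@plus Y x (z n)) < 1) ->
  (forall m, m < 1 -> exists n, m < norm (@plus Y x (z n))) ->
  (forall n, norm (z n) <= q) ->
  (forall g : dual Y, norm g <= 1 ->
     exists N, forall n, (N <= n)%nat -> abs (g (@plus Y x (z n))) <= s) ->
  ~ ACPP (l1 F) Y.
Proof.
  intros hfx hx hq hs hlt hone hz hlim hacpp.
  destruct (l1_operator_exists F Y (fun n => @plus Y x (z n)) 1) as [T hT].
  { intros k; apply Rlt_le, hlt. }
  destruct (l1_constant_operator F Y f x hfx) as [K [hKc hK]].
  assert (hq0 : 0 <= q) by (apply Rle_trans with (2 := hz O), norm_ge_0).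
  assert (hess : ess_norm T <= q).
  { apply Rle_trans with (norm (minus T K)).
    - apply (proj1 (ess_norm_glb T)); exists K; auto.
    - apply op_norm_le; intros a ha.
      apply Rle_trans with (q * norm a).
      + apply l1_operator_le; [exact hq0 |]; intros k.
        transitivity (norm (z k)); [apply Req_le | apply hz].
        change (norm (plus (T (l1_basis F k)) (opp (K (l1_basis F k)))) = norm (z k)).
        rewrite hT, hK; f_equal.
        rewrite (plus_comm x), <- plus_assoc.
        transitivity (plus (z k) zero); [f_equal; exact (@plus_opp_r Y x) | apply plus_zero_r].
      + generalize (norm_ge_0 a); nra. }
  assert (hTe : forall n, norm (@plus Y x (z n)) <= norm T).
  { intros n; rewrite <- hT; apply op_norm_ball; rewrite l1_norm_basis; lra. }
  assert (hadj : forall m, norm (adjoint T) <= m -> 1 <= m).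
  { intros m hm; apply Rnot_lt_le; intros hm1.
    destruct (hone m hm1) as [n hn].
    destruct (norming_functional F Y (@plus Y x (z n))) as [g [hg hgn]].
    assert (h1 : norm (adjoint T g) <= norm (adjoint T)) by (apply op_norm_ball; exact hg).
    assert (h2 : norm (adjoint T g (l1_basis F n)) <= norm (adjoint T g)).
    { apply op_norm_ball; rewrite l1_norm_basis; lra. }
    change (norm (adjoint T g (l1_basis F n))) with (abs (g (T (l1_basis F n)))) in h2.
    rewrite hT in h2; lra. }
  assert (hnot : ~ attains_norm (adjoint T)).
  { intros [g [hg hatt]].
    destruct (hlim g (Req_le _ _ hg)) as [N hN].
    assert (hinit : exists m, m < 1 /\ forall n, (n < N)%nat -> norm (@plus Y x (z n)) <= m).
    { clear hN; induction N as [| N [m [hm IH]]]; [exists 0; split; [lra | intros; lia] |].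
      exists (Rmax m (norm (@plus Y x (z N)))); split; [now apply Rmax_lub_lt |].
      intros n hn; destruct (Nat.eq_dec n N) as [-> | hne]; [apply Rmax_r |].
      apply Rle_trans with (2 := Rmax_l _ _), IH; lia. }
    destruct hinit as [m [hm hinit]].
    assert (hM : Rmax 0 (Rmax m s) < 1) by (repeat apply Rmax_lub_lt; lra).
    apply (Rlt_not_le _ _ hM), hadj; rewrite <- hatt.
    apply op_norm_le; intros a ha.
    apply Rle_trans with (Rmax 0 (Rmax m s) * norm a).
    - apply l1_operator_le; [apply Rmax_l |]; intros k.
      change (abs (g (T (l1_basis F k))) <= Rmax 0 (Rmax m s)); rewrite hT.
      apply Rle_trans with (2 := Rmax_r _ _).
      destruct (Compare_dec.le_lt_dec N k) as [hk | hk].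
      + apply Rle_trans with (2 := Rmax_r _ _), hN, hk.
      + apply Rle_trans with (2 := Rmax_l _ _), Rle_trans with (2 := hinit k hk).
        apply dual_ball_le; lra.
    - generalize (norm_ge_0 a) (Rmax_l 0 (Rmax m s)); nra. }
  assert (hnorm := hacpp T hnot); destruct (hone q hq) as [n hn].
  generalize (hTe n); lra.
Qed.

(** The constant [eps] is chosen so that a perturbation of size [4 * eps] neither leaves
    the slice nor brings [norm x] up to 1. *)
Lemma not_ACPP_of_small_slice (F : scalars) (Y : CompleteNormedModule (field F))
  (f : dual Y) (delta r : R) :
  ~ finite_dimensional Y -> ~ contains_copy (l1 F) Y ->
  norm f = 1 -> 0 < delta -> r < 2 ->
  (forall u v : Y, slice f delta u -> slice f delta v -> norm (@minus Y u v) <= r) ->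
  ~ ACPP (l1 F) Y.
Proof.
  intros hdim hl1 hf hdelta hr hdiam.
  destruct (slice_interior_point F Y f delta hf hdelta) as [x [hx [hfx0 hfx]]].
  set (eps := Rmin ((1 - norm x) / 8) ((re (f x) - (1 - delta)) / 8)).
  assert (heps : 0 < eps /\ eps <= (1 - norm x) / 8 /\ eps <= (re (f x) - (1 - delta)) / 8).
  { unfold eps; repeat split; [apply Rmin_glb_lt; lra | apply Rmin_l | apply Rmin_r]. }
  destruct (nearly_weakly_null_sequence F Y eps hdim hl1 (proj1 heps)) as [w [hw hwnull]].
  destruct (hwnull f (Req_le _ _ hf)) as [N0 hN0].
  set (c := fun n => 1 - (1 - norm x) * / INR (n + 2)).
  assert (hc : forall n, norm x < c n < 1).
  { intros n; unfold c.
    assert (h2 : 2 <= INR (n + 2)) by (apply (le_INR 2); lia).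
    assert (h0 : 0 < / INR (n + 2)) by (apply Rinv_0_lt_compat; lra).
    assert (h1 : / INR (n + 2) <= / 2) by (apply Rinv_le_contravar; lra).
    split; nra. }
  destruct (sequence_choice (fun n z => norm (@plus Y x z) = c n /\ norm z <= r / 2 /\
     forall g : dual Y, abs (g (w (N0 + n)%nat)) <= eps -> abs (g z) <= 4 * eps)) as [z hz].
  { intros n; destruct (symmetric_level F Y x (w (N0 + n)%nat) (c n) (hc n) (hw _))
      as [t [ht [hplus hminus]]].
    set (z := scal (of_R F t) (w (N0 + n)%nat)) in *.
    assert (hgz : forall g : dual Y, abs (g (w (N0 + n)%nat)) <= eps -> abs (g z) <= 4 * eps).
    { intros g hg; unfold z; rewrite (linear_scal _ (bop_linear g)).
      change (abs (mult (of_R F t) (g (w (N0 + n)%nat))) <= 4 * eps).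
      rewrite abs_mult_eq, abs_of_R.
      apply Rmult_le_compat; auto; [apply Rabs_pos | apply abs_ge_0]. }
    exists z; split; [exact hplus | split; [| exact hgz]].
    assert (hfz : Rabs (re (f z)) <= 4 * eps).
    { apply Rle_trans with (1 := re_le_abs F (f z)), hgz, hN0; lia. }
    apply Rabs_le_between in hfz.
    assert (hd := hdiam (@plus Y x z) (@minus Y x z)); rewrite norm_symmetric_gap in hd.
    enough (2 * norm z <= r) by lra; apply hd; split.
    - apply Rle_trans with (1 := Req_le _ _ hplus), Rlt_le, hc.
    - rewrite (linear_plus _ (bop_linear f)); rewrite re_plus; lra.
    - apply Rle_trans with (1 := hminus), Rlt_le, hc.
    - rewrite bop_minus; unfold minus; rewrite re_plus, re_opp; lra. }
  apply (not_ACPP_of_perturbations F Y f x z (r / 2) (norm x + 4 * eps)); try lra.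
  - intros n; rewrite (proj1 (hz n)); apply hc.
  - intros m hm.
    destruct (archimed_cor1 (1 - m)) as [n [hn hn0]]; [lra |].
    exists n; rewrite (proj1 (hz n)); unfold c.
    assert (hinv : / INR (n + 2) <= / INR n).
    { apply Rinv_le_contravar; [now apply lt_0_INR | apply le_INR; lia]. }
    assert (0 < / INR (n + 2)) by (apply Rinv_0_lt_compat, lt_0_INR; lia).
    generalize (norm_ge_0 x); nra.
  - intros n; apply hz.
  - intros g hg; destruct (hwnull g hg) as [N hN]; exists N; intros n hn.
    rewrite (linear_plus _ (bop_linear g)).
    apply Rle_trans with (1 := abs_triangle (g x) (g (z n))).
    apply Rplus_le_compat; [now apply dual_ball_le |].
    apply hz, hN; lia.
Qed.

Theorem theorem2p4 (F : scalars) (Y : CompleteNormedModule (field F))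
  (hdim : ~ finite_dimensional Y)
  (hl1 : ~ contains_copy (l1 F) Y)
  (hacpp : ACPP (l1 F) Y) :
  LD2P Y.
Proof.
  intros f delta hf hdelta; apply is_lub_Rbar_unique; split.
  - intros r [u [v [[hu _] [[hv _] ->]]]]; simpl.
    generalize (norm_minus_le F Y u v); simpl in *; lra.
  - destruct (slice_interior_point F Y f delta hf hdelta) as [x [hx [_ hfx]]].
    assert (hsx : slice f delta x) by (split; lra).
    intros b hb; destruct b as [r | |]; simpl; [| exact I |].
    + apply Rnot_lt_le; intros hr.
      apply (not_ACPP_of_small_slice F Y f delta r hdim hl1 hf hdelta hr); [| exact hacpp].
      intros u v hu hv; apply (hb (norm (@minus Y u v))); exists u, v; auto.
    + apply (hb (norm (@minus Y x x))); exists x, x; auto.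
Qed.
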